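(* There exist universal numerical constants $C_1,C_2,C_3>0$ such that the following holds for all $\lambda,\eta>0$. On the score event $\mathcal S_T(\lambda,\eta)$, the estimator $\widehat A_{\lambda,\eta}$ satisfies, for all $r\in\{0,\ldots,d\}$, $$\big\|(\widehat A_{\lambda,\eta}-A_0)B_{T,\eta}\big\|_F^2\le C_1\,\mathfrak a_{r,T,\eta}(A_0)+C_2\lambda^2r+C_3\eta^2\big\|A_0B_{T,\eta}^{-1}\big\|_F^2.$$ Moreover, suppose that there exist a constant $c_0>0$, independent of $d$ and $T$, and a number $\pi_T\in[0,1]$ such that $\mathbb P_{A_0}(\mathcal R_T(c_0))\ge1-\pi_T$. Then on the event $\mathcal S_T(\lambda,\eta)\cap\mathcal R_T(c_0)$, for all $r\in\{0,\ldots,d\}$, $$\big\|\widehat A_{\lambda,\eta}-A_0\big\|_F^2\le\frac{C_1}{c_0}\mathfrak a_{r,T,\eta}(A_0)+\frac{C_2}{c_0}\lambda^2r+\frac{C_3}{c_0}\eta^2\big\|A_0B_{T,\eta}^{-1}\big\|_F^2\le\frac{C_1}{c_0}\mathfrak a_{r,T,\eta}(A_0)+\frac{C_2}{c_0}\lambda^2r+\frac{C_3}{c_0^2}\eta^2\|A_0\|_F^2.$$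
   Context: Let $T>0$, $d\in\mathbb N$, $A_0\in\mathbb R^{d\times d}$, and let $(X_t)_{0\le t\le T}$ be the $d$-dimensional Ornstein-Uhlenbeck process $dX_t=-A_0X_t\,dt+dW_t$, $X_0=0$, with $W$ a standard $d$-dimensional Brownian motion; $\mathbb P_{A_0}$ denotes the underlying probability. Define $$C_T:=\frac1T\int_0^TX_tX_t^\top\,dt,\qquad \varepsilon_T:=\frac1T\int_0^TdW_t\,X_t^\top,$$ and, for $\eta>0$, $B_{T,\eta}:=(C_T+\eta I_d)^{1/2}$. The likelihood contrast is $$\mathcal L_T(A):=\frac1T\int_0^T\langle AX_t,dX_t\rangle+\frac1{2T}\int_0^T\|AX_t\|_2^2\,dt,\qquad A\in\mathbb R^{d\times d}.$$ For $\lambda,\eta>0$, the Weighted Nuclear Elastic Net Estimator $\widehat A_{\lambda,\eta}$ is any minimizer over $A\in\mathbb R^{d\times d}$ of $$\mathcal L_T(A)+\frac\eta2\|A\|_F^2+\lambda\|AB_{T,\eta}\|_*.$$ The score event is $\mathcal S_T(\lambda,\eta):=\{2\|\varepsilon_TB_{T,\eta}^{-1}\|_{\mathrm{op}}\le\lambda\}$. The curvature event is $$\mathcal R_T(c_0):=\left\{\|MB_{T,\eta}\|_F^2\ge c_0\|M\|_F^2\ \text{for every }M\in\mathbb R^{d\times d}\right\}.$$ The weighted approximation error is $$\mathfrak a_{r,T,\eta}(A_0):=\inf_{A\in\mathbb R^{d\times d},\ \operatorname{rank}(A)\le r}\|(A-A_0)B_{T,\eta}\|_F^2.$$ $\|\cdot\|_F,\|\cdot\|_{\mathrm{op}},\|\cdot\|_*$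 are the Frobenius, operator and nuclear norms. *)

(* Defs.v *)
From HB Require Import structures.
From mathcomp Require Export all_boot all_order all_algebra.
From mathcomp Require Export all_classical all_reals all_analysis.
Export Order.TTheory GRing.Theory Num.Theory.
Export numFieldNormedType.Exports.

Set Implicit Arguments.
Unset Strict Implicit.
Unset Printing Implicit Defensive.

Local Open Scope classical_set_scope.
Local Open Scope ring_scope.

Definition dotv {R : realType} {n : nat} (u v : 'cV[R]_n) : R :=
  \sum_(i < n) u i 0 * v i 0.

(* On column vectors this is the Euclidean norm; the library's norm on
   matrices is the maximum norm. *)
Definition frobenius {R : realType} {m n : nat} (M : 'M[R]_(m, n)) : R :=
  Num.sqrt (\sum_(i < m) \sum_(j < n) M i j ^+ 2).

Definition opnorm {R : realType} {m n : nat} (M : 'M[R]_(m, n)) : R :=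
  sup [set frobenius (M *m x) | x in [set x : 'cV[R]_n | frobenius x <= 1]].

Definition psd {R : realType} {n : nat} (S : 'M[R]_n) : Prop :=
  S^T = S /\ forall x : 'cV[R]_n, 0 <= dotv x (S *m x).

(* A positive semidefinite matrix has exactly one positive semidefinite square
   root, so the choice made by [xget] is immaterial on such matrices; the
   value 0 elsewhere is junk. *)
Definition sqrtmx {R : realType} {n : nat} (S : 'M[R]_n) : 'M[R]_n :=
  xget 0 [set Q : 'M[R]_n | psd Q /\ Q *m Q = S].

(* The eigenvalues of (M^T M)^(1/2) are the singular values of M. *)
Definition nuclear {R : realType} {m n : nat} (M : 'M[R]_(m, n)) : R :=
  \tr (sqrtmx (M^T *m M)).

Section Processes.
Context {R : realType} {disp : measure_display} {Omega : measurableType disp}.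
Variables (P : probability Omega R) (T : R).

(* Standard d-dimensional Brownian motion on [0, T]. The last clause says at
   once that the increments over consecutive intervals are independent, that
   the d coordinates of each are independent, and that each coordinate is
   centred normal with variance the length of the interval (the second
   parameter of [normal_prob] is the standard deviation). *)
Definition brownian {d : nat} (W : R -> Omega -> 'cV[R]_d) : Prop :=
  [/\ forall (t : R) i, 0 <= t <= T -> measurable_fun setT (fun w => W t w i 0),
      {ae P, forall w, W 0 w = 0},
      {ae P, forall w, {within `[0, T], continuous (fun t => W t w)}} &
      forall (n : nat) (t : nat -> R) (E : 'I_n -> 'I_d -> set R),
        0 <= t 0%N -> t n <= T -> (forall k, (k < n)%N -> t k < t k.+1) ->
        (forall k i, measurable (E k i)) ->
        P [set w | forall k i, E k i ((W (t k.+1) w - W (t k) w) i 0)] =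
        (\prod_(k < n) \prod_(i < d)
           normal_prob 0 (Num.sqrt (t k.+1 - t k)) (E k i))%E].

(* dX_t = - A0 X_t dt + dW_t, X_0 = 0; since the noise is additive, the
   integral form of the equation involves no stochastic integral. *)
Definition ornstein_uhlenbeck {d : nat} (A0 : 'M[R]_d)
    (W X : R -> Omega -> 'cV[R]_d) : Prop :=
  [/\ forall (t : R) i, 0 <= t <= T -> measurable_fun setT (fun w => X t w i 0),
      {ae P, forall w, X 0 w = 0},
      {ae P, forall w, {within `[0, T], continuous (fun t => X t w)}} &
      {ae P, forall w, forall t : R, 0 <= t <= T ->
        X t w =
        \col_i (\int[lebesgue_measure]_(s in `[0, t]) (- A0 *m X s w) i 0)
        + W t w}].

(* Left-endpoint sum of <H, dY> along the subdivision 0 :: s of [0, T]. *)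
Definition riemann_sum {n : nat} (s : seq R) (H Y : R -> 'cV[R]_n) : R :=
  \sum_(k < size s)
    dotv (H (nth T (0 :: s) k)) (Y (nth T s k) - Y (nth T (0 :: s) k)).

(* I is a version of the Ito integral \int_0^T <H_t, dY_t>, for H and Y
   continuous semimartingales of a common filtration: the limit in probability
   of the left-endpoint sums as the mesh of the subdivision tends to 0. This
   determines I up to a null set. *)
Definition ito_integral {n : nat} (H Y : R -> Omega -> 'cV[R]_n)
    (I : Omega -> R) : Prop :=
  measurable_fun setT I /\
  forall e p : R, 0 < e -> 0 < p -> exists2 delta : R, 0 < delta &
    forall s : seq R, itv_partition 0 T s ->
      (forall k, (k < size s)%N -> nth T s k - nth T (0 :: s) k < delta) ->
      (P [set w | (e <= `|riemann_sum s (H ^~ w) (Y ^~ w) - I w|)%R] <= p%:E)%E.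

(* J is a version of the matrix integral \int_0^T dY_t H_t^T, whose (i, j)
   entry is \int_0^T H^j_t dY^i_t; a row of a column vector is a vector of
   dimension 1. *)
Definition ito_integral_mx {m n : nat} (Y : R -> Omega -> 'cV[R]_m)
    (H : R -> Omega -> 'cV[R]_n) (J : Omega -> 'M[R]_(m, n)) : Prop :=
  forall i j, ito_integral (fun t w => row j (H t w))
                           (fun t w => row i (Y t w)) (fun w => J w i j).

(* I is a version of the random field A |-> \int_0^T <A X_t, dX_t>. Each value
   is defined up to a null set only, and minimizing a function of A built from
   I is meaningless unless a version that is regular in A is chosen, hence the
   continuity. *)
Definition ito_field {d : nat} (X : R -> Omega -> 'cV[R]_d)
    (I : 'M[R]_d -> Omega -> R) : Prop :=
  (forall A, ito_integral (fun t w => A *m X t w) X (I A)) /\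
  {ae P, forall w, continuous (fun A => I A w)}.

End Processes.

Section Estimator.
Context {R : realType} {Omega : Type} {d : nat}.
Variables (T : R) (X : R -> Omega -> 'cV[R]_d).

Definition CT (w : Omega) : 'M[R]_d :=
  T^-1 *: \matrix_(i, j)
    (\int[lebesgue_measure]_(t in `[0, T]) (X t w i 0 * X t w j 0)).

Definition BT (eta : R) (w : Omega) : 'M[R]_d := sqrtmx (CT w + eta%:M).

(* J stands for \int_0^T dW_t X_t^T. *)
Definition epsT (J : Omega -> 'M[R]_d) (w : Omega) : 'M[R]_d := T^-1 *: J w.

(* I A stands for \int_0^T <A X_t, dX_t>. *)
Definition contrast (I : 'M[R]_d -> Omega -> R) (w : Omega) (A : 'M[R]_d) : R :=
  T^-1 * I A w
  + (2 * T)^-1 *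
    \int[lebesgue_measure]_(t in `[0, T]) (frobenius (A *m X t w) ^+ 2).

Definition objective (I : 'M[R]_d -> Omega -> R) (lambda eta : R) (w : Omega)
    (A : 'M[R]_d) : R :=
  contrast I w A + eta / 2 * frobenius A ^+ 2
  + lambda * nuclear (A *m BT eta w).

Definition wnen_estimate (I : 'M[R]_d -> Omega -> R) (lambda eta : R)
    (w : Omega) (Ahat : 'M[R]_d) : Prop :=
  forall A, objective I lambda eta w Ahat <= objective I lambda eta w A.

Definition score_event (J : Omega -> 'M[R]_d) (lambda eta : R) : set Omega :=
  [set w | 2 * opnorm (epsT J w *m invmx (BT eta w)) <= lambda].

Definition curvature_event (eta c0 : R) : set Omega :=
  [set w | forall M : 'M[R]_d,
     c0 * frobenius M ^+ 2 <= frobenius (M *m BT eta w) ^+ 2].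

Definition approx_error (A0 : 'M[R]_d) (r : nat) (eta : R) (w : Omega) : R :=
  inf [set frobenius ((A - A0) *m BT eta w) ^+ 2 |
         A in [set A : 'M[R]_d | (\rank A <= r)%N]].

End Estimator.

(* Main.v *)
Require Import Defs.
From mathcomp Require Import complex ring lra measurable_realfun.

(** Write B for the weight matrix, C for the empirical covariance and J for the
    matrix integral of X against dW, so that the score matrix is J / T.

    The probabilistic content is one identity: almost surely, for all matrices
    A at once, the integral of <A X, dX> equals <A, J> - T <A C, A0> (Frobenius
    inner product), which is what replacing dX by - A0 X dt + dW suggests
    ([ito_fieldE]).  For a fixed A, take the left-endpoint sums along uniform
    subdivisions.  Subtracting the linear combination of the sums for the
    entries of J leaves ordinary Riemann sums, which converge on every
    continuous path ([ou_riemann_cvg]); the same differences converge in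
    probability to the difference of the stochastic integrals, and the two
    limits agree almost surely ([cvg_prob_ae_unique]).  This gives the identity
    for all rational A at once, and continuity in A gives it for all A.

    On a path where the identity holds everything is deterministic.  Since
    B B = C + eta I is positive definite, completing the square in N = A B
    turns the objective into
      |N - A0 B|^2 / 2 + <N, Z> + <N, U> + lambda |N|_nuc  +  constant,
    with Z the score matrix times B^-1 and U = eta A0 B^-1 ([objectiveE]), and
    the score event says that |Z|_op <= lambda / 2.  Comparing the minimizer
    Nh with a matrix N of rank at most r, one needs
      lambda (|N|_nuc - |Nh|_nuc) - <Nh - N, Z> <= 2 lambda sqrt r |Nh - N|_F
    ([nuclear_noise_le]).  Let Q be the partial isometry of the polar
    decomposition of N, and P1 = Q Q^T, P2 = Q^T Q.  The matrix
    V = Q - (1 - P1) (Z / lambda) (1 - P2) has operator norm at most 1, so that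
    <Nh, V> <= |Nh|_nuc, while <N, V> = |N|_nuc.  Hence the left-hand side is at
    most - <Nh - N, lambda Q + (Z - (1 - P1) Z (1 - P2))>, and the matrix on the
    right has Frobenius norm at most 2 lambda sqrt r.  Cauchy-Schwarz and the
    arithmetic-geometric mean inequality then give the oracle inequality with
    the constants 4, 48 and 12 ([nuclear_oracle]).

    The nuclear norm is the trace of a positive semidefinite square root, so
    these arguments use the spectral theorem for real symmetric matrices: an
    eigenvector is found over the complex numbers and its eigenvalue is real,
    and a Householder reflection reduces the dimension ([sym_diag]).

    The bounds on the curvature event follow from the first one by applying the
    event to Ahat - A0 and to A0 B^-1. *)

Set Implicit Arguments.
Unset Strict Implicit.
Unset Printing Implicit Defensive.

Local Open Scope classical_set_scope.
Local Open Scope ring_scope.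

(** * Frobenius inner product *)

Section Frobenius.
Context {R : realType}.

(** The Frobenius inner product of two matrices, as tr (M^T N). *)
Definition fdot {m n : nat} (M N : 'M[R]_(m, n)) : R := \tr (M^T *m N).

Lemma fdotE m n (M N : 'M[R]_(m, n)) :
  fdot M N = \sum_(i < m) \sum_(j < n) M i j * N i j.
Proof.
rewrite exchange_big/= /fdot /mxtrace; apply: eq_bigr => j _.
by rewrite mxE; apply: eq_bigr => i _; rewrite mxE.
Qed.

Lemma fdotC m n (M N : 'M[R]_(m, n)) : fdot M N = fdot N M.
Proof. by rewrite /fdot -mxtrace_tr trmx_mul trmxK. Qed.

Lemma fdotDl m n (M N P : 'M[R]_(m, n)) : fdot (M + N) P = fdot M P + fdot N P.
Proof. by rewrite /fdot raddfD mulmxDl raddfD. Qed.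

Lemma fdotDr m n (M N P : 'M[R]_(m, n)) : fdot P (M + N) = fdot P M + fdot P N.
Proof. by rewrite fdotC fdotDl !(fdotC P). Qed.

Lemma fdotZl m n (a : R) (M N : 'M[R]_(m, n)) : fdot (a *: M) N = a * fdot M N.
Proof. by rewrite /fdot linearZ -scalemxAl linearZ. Qed.

Lemma fdotZr m n (a : R) (M N : 'M[R]_(m, n)) : fdot M (a *: N) = a * fdot M N.
Proof. by rewrite fdotC fdotZl fdotC. Qed.

Lemma fdotNl m n (M N : 'M[R]_(m, n)) : fdot (- M) N = - fdot M N.
Proof. by rewrite -scaleN1r fdotZl mulN1r. Qed.

Lemma fdotNr m n (M N : 'M[R]_(m, n)) : fdot M (- N) = - fdot M N.
Proof. by rewrite fdotC fdotNl fdotC. Qed.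

Definition fdot_lin := (@fdotDl, @fdotDr, @fdotNl, @fdotNr, @fdotZl, @fdotZr).

Lemma fdot_mull m n p (A : 'M[R]_(m, n)) (M : 'M[R]_(n, p)) (N : 'M[R]_(m, p)) :
  fdot (A *m M) N = fdot M (A^T *m N).
Proof. by rewrite /fdot trmx_mul mulmxA. Qed.

Lemma fdot_mulr m n p (A : 'M[R]_(n, p)) (M : 'M[R]_(m, n)) (N : 'M[R]_(m, p)) :
  fdot (M *m A) N = fdot M (N *m A^T).
Proof. by rewrite /fdot trmx_mul -mulmxA mxtrace_mulC mulmxA. Qed.

Lemma dotvE n (u v : 'cV[R]_n) : dotv u v = fdot u v.
Proof. by rewrite fdotE; apply: eq_bigr => i _; rewrite big_ord1. Qed.

Lemma frobenius_ge0 m n (M : 'M[R]_(m, n)) : 0 <= frobenius M.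
Proof. exact: sqrtr_ge0. Qed.

Lemma frobenius2 m n (M : 'M[R]_(m, n)) : frobenius M ^+ 2 = fdot M M.
Proof.
rewrite sqr_sqrtr ?fdotE//.
by do 2!apply: sumr_ge0 => ? _; exact: sqr_ge0.
Qed.

Lemma fdot_ge0 m n (M : 'M[R]_(m, n)) : 0 <= fdot M M.
Proof. by rewrite -frobenius2 sqr_ge0. Qed.

Lemma fdot_eq0 m n (M : 'M[R]_(m, n)) : fdot M M = 0 -> M = 0.
Proof.
rewrite fdotE => /eqP; rewrite psumr_eq0 => [/allP M0|i _]; last first.
  by apply: sumr_ge0 => j _; exact: sqr_ge0.
apply/matrixP => i j; move: (M0 i (mem_index_enum _)).
rewrite implyTb psumr_eq0 => [/allP/(_ j (mem_index_enum _))|k _]; last first.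
  exact: sqr_ge0.
by rewrite implyTb mxE mulf_eq0 orbb => /eqP.
Qed.

Lemma frobenius_eq0 m n (M : 'M[R]_(m, n)) : frobenius M = 0 -> M = 0.
Proof. by move=> M0; apply: fdot_eq0; rewrite -frobenius2 M0 expr0n. Qed.

(** The Cauchy-Schwarz inequality. *)
Lemma fdot_le m n (M N : 'M[R]_(m, n)) : fdot M N <= frobenius M * frobenius N.
Proof.
(* 0 <= |b M - a N|^2 with a = |M| and b = |N| *)
have := fdot_ge0 (frobenius N *: M - frobenius M *: N).
rewrite !fdot_lin -!frobenius2 (fdotC N M).
have := frobenius_ge0 M; have := frobenius_ge0 N.
rewrite le_eqVlt => /predU1P[/esym N0 _ _|N0].
  by rewrite N0 (frobenius_eq0 N0) /fdot mulmx0 mxtrace0 mulr0.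
rewrite le_eqVlt => /predU1P[/esym M0 _|M0].
  by rewrite M0 (frobenius_eq0 M0) /fdot trmx0 mul0mx mxtrace0 mul0r.
move: (frobenius M) (frobenius N) M0 N0 => a b a0 b0 H.
have ab := mulr_gt0 a0 b0.
by rewrite -(ler_pM2l ab); nra.
Qed.

Lemma frobeniusZ m n (a : R) (M : 'M[R]_(m, n)) :
  frobenius (a *: M) = `|a| * frobenius M.
Proof.
apply/eqP; rewrite -(@eqrXn2 _ 2)// ?mulr_ge0 ?frobenius_ge0//.
by rewrite exprMn !frobenius2 !fdot_lin real_normK ?num_real// mulrA expr2.
Qed.

Lemma ler_frobeniusD m n (M N : 'M[R]_(m, n)) :
  frobenius (M + N) <= frobenius M + frobenius N.
Proof.
rewrite -(@ler_pXn2r _ 2)// ?nnegrE ?addr_ge0 ?frobenius_ge0//.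
rewrite frobenius2 !fdot_lin -!frobenius2 (fdotC N M).
by have := fdot_le M N; nra.
Qed.

Lemma frobeniusN m n (M : 'M[R]_(m, n)) : frobenius (- M) = frobenius M.
Proof. by rewrite -scaleN1r frobeniusZ normrN1 mul1r. Qed.

Lemma frobenius2_col m n p (M : 'M[R]_(m, n)) (N : 'M[R]_(n, p)) :
  frobenius (M *m N) ^+ 2 = \sum_(j < p) frobenius (M *m col j N) ^+ 2.
Proof.
rewrite frobenius2 fdotE exchange_big/=; apply: eq_bigr => j _.
rewrite frobenius2 fdotE; apply: eq_bigr => i _.
by rewrite big_ord1 colE mulmxA -colE !mxE.
Qed.

Lemma frobenius_mulmx_le m n (M : 'M[R]_(m, n)) (x : 'cV[R]_n) :
  frobenius (M *m x) <= frobenius M * frobenius x.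
Proof.
rewrite -(@ler_pXn2r _ 2)// ?nnegrE ?mulr_ge0 ?frobenius_ge0//.
rewrite frobenius2 fdotE exprMn (frobenius2 M) fdotE mulr_suml.
apply: ler_sum => i _; rewrite big_ord1.
(* Cauchy-Schwarz for the row and for its opposite bounds the square *)
have := fdot_le (row i M)^T x.
have := fdot_le (- (row i M))^T x.
rewrite /fdot !trmxK trace_mx11 trace_mx11 mulNmx -row_mul mxE mxE.
rewrite raddfN/= frobeniusN.
have <- : frobenius (row i M)^T ^+ 2 = \sum_j M i j * M i j.
  by rewrite frobenius2 fdotE; apply: eq_bigr => j _; rewrite big_ord1 !mxE.
have := frobenius_ge0 (row i M)^T; have := frobenius_ge0 x.
move: (_ i 0) (frobenius _) (frobenius _) => y b a b0 a0 h1 h2; nra.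
Qed.

End Frobenius.

(** * Spectral theorem for real symmetric matrices *)

Section Spectral.
Context {R : realType}.

(** A complex eigenvalue a of S is real: if v S = a v then v S v^* equals both
    a |v|^2 and its conjugate. *)
Lemma sym_eigenvector n (S : 'M[R]_n.+1) : S^T = S ->
  exists a (v : 'cV[R]_n.+1), v != 0 /\ S *m v = a *: v.
Proof.
move=> Ssym; pose C : numClosedFieldType := R[i].
pose f : {rmorphism R -> C} := real_complex R.
have [a /[dup] aev /eigenvalueP[v vS v0]] :
  exists a : C, eigenvalue (map_mx f S) a by exact: eigenvalue_closed.
have aR : a \is Num.real.
  pose w := map_mx Num.conj v.
  have wS : w *m map_mx f S = a^* *: w.
    rewrite -map_mxZ -vS map_mxM; congr (_ *m _).
    apply/matrixP => i j; rewrite !mxE; apply/esym/CrealP.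
    by rewrite complex_real.
  have : a * \tr (v *m w^T) = a^* * \tr (v *m w^T).
    rewrite -!mxtraceZ scalemxAl -vS scalemxAr -linearZ/= -wS.
    by rewrite trmx_mul (map_trmx f S) Ssym mulmxA.
  have vw0 : \tr (v *m w^T) != 0.
    rewrite trace_mx11 mxE; apply: contra v0 => vw0.
    move: vw0; rewrite psumr_eq0 => [/allP vw0|j _]; last first.
      by rewrite !mxE mul_conjC_ge0.
    apply/eqP/matrixP => i j; rewrite ord1 [RHS]mxE.
    by have := vw0 j (mem_index_enum _); rewrite implyTb !mxE mul_conjC_eq0 => /eqP.
  by move/(mulIf vw0) => /esym/CrealP.
have aE : f (complex.Re a) = a by exact: RRe_real.
move: aev; rewrite eigenvalue_root_char -map_char_poly -aE fmorph_root.
rewrite -eigenvalue_root_char => /eigenvalueP[u uS u0].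
exists (complex.Re a), u^T; rewrite trmx_eq0; split => //.
by rewrite -[in LHS]Ssym -trmx_mul uS linearZ.
Qed.

(** Every unit vector is the image of the first basis vector e by an orthogonal
    matrix: the Householder reflection with respect to v - e. *)
Lemma orthogonal_map_e0 n (v : 'cV[R]_(1 + n)) : v^T *m v = 1%:M ->
  exists2 H : 'M[R]_(1 + n), H^T *m H = 1%:M & H^T *m delta_mx 0 0 = v.
Proof.
move=> v1; pose e : 'cV[R]_(1 + n) := delta_mx 0 0; rewrite -/e.
have e1 : e^T *m e = 1%:M.
  by rewrite trmx_delta mul_delta_mx; apply/matrixP => i j; rewrite !ord1 !mxE.
have [->|ve] := eqVneq v e.
  by exists 1%:M; rewrite trmx1 mul1mx.
have ev : e^T *m v = v^T *m e.
  rewrite [LHS]mx11_scalar [RHS]mx11_scalar -!trace_mx11; congr (_%:M).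
  exact: fdotC.
pose u := v - e; pose t := (v^T *m e) 0 0.
have vet : v^T *m e = t%:M by rewrite [LHS]mx11_scalar.
have uT : u^T = v^T - e^T by rewrite raddfB.
have uu : u^T *m u = (2 * (1 - t))%:M.
  rewrite uT /u mulmxBl !mulmxBr v1 e1 ev vet.
  by rewrite -!raddfB/=; congr (_%:M); ring.
have uv : u^T *m e = (t - 1)%:M.
  by rewrite uT mulmxBl e1 vet -raddfB.
have t1 : 1 - t != 0.
  apply: contra_neq ve => t1; apply/eqP; rewrite -subr_eq0; apply/eqP.
  by apply: fdot_eq0; rewrite /fdot uu t1 mulr0 raddf0 mxtrace0.
pose H : 'M[R]_(1 + n) := 1%:M - (1 - t)^-1 *: (u *m u^T).
have HT : H^T = H.
  by rewrite /H raddfB/= linearZ/= trmx_mul trmxK trmx1.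
exists H; rewrite HT.
  have XX : (u *m u^T) *m (u *m u^T) = (2 * (1 - t)) *: (u *m u^T).
    by rewrite -mulmxA (mulmxA u^T) uu mul_scalar_mx -scalemxAr.
  rewrite /H mulmxBl mul1mx mulmxBr mulmx1 -scalemxAl -scalemxAr XX !scalerA.
  rewrite -[RHS]subr0 -addrA -opprD; congr (_ - _).
  rewrite addrA -scalerDl -scalerBl -[RHS](scale0r (u *m u^T)).
  by congr (_ *: _); field.
rewrite /H mulmxBl mul1mx -scalemxAl -mulmxA uv mul_mx_scalar scalerA.
have -> : (1 - t)^-1 * (t - 1) = -1 by field.
by rewrite scaleN1r opprK /u addrC subrK.
Qed.

(** Orthogonal diagonalization, with the eigenvectors as the rows of U. *)
Lemma sym_diag n (S : 'M[R]_n) : S^T = S ->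
  exists (U : 'M[R]_n) (h : 'rV[R]_n),
    U^T *m U = 1%:M /\ S = U^T *m diag_mx h *m U.
Proof.
elim: n S => [|n IH] S Ssym.
  by exists 1%:M, 0; split; apply/matrixP => -[].
have [a [v0 [v0n0 Sv0]]] := sym_eigenvector Ssym.
have f0 : frobenius v0 != 0 by apply: contra_neq v0n0; exact: frobenius_eq0.
pose v := (frobenius v0)^-1 *: v0.
have Sv : S *m v = a *: v by rewrite -scalemxAr Sv0 scalerA mulrC -scalerA.
have v1 : v^T *m v = 1%:M.
  rewrite [LHS]mx11_scalar -trace_mx11 -[\tr _]/(fdot v v) !fdot_lin -frobenius2.
  by congr (_%:M); field.
have [H HH He] := @orthogonal_map_e0 n v v1.
have HH' := mulmx1C HH.
pose S' : 'M[R]_(1 + n) := H *m S *m H^T.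
have S'sym : S'^T = S' by rewrite /S' !trmx_mul trmxK Ssym mulmxA.
have S'e : S' *m delta_mx 0 0 = a *: (delta_mx 0 0 : 'cV[R]_(1 + n)).
  by rewrite /S' -!mulmxA He Sv -He -scalemxAr mulmxA HH' mul1mx.
have S'0 i : S' i (lshift n 0) = a * (i == 0)%:R.
  have /(congr1 (fun M : 'cV_(1 + n) => M i 0)) := S'e.
  rewrite -colE [X in X = _]mxE [X in _ = X]mxE [X in _ = _ * X]mxE.
  by rewrite andbT => <-; congr (S' i _); exact: val_inj.
have S'ul : ulsubmx S' = a%:M.
  by apply/matrixP => i j; rewrite !ord1 2!mxE S'0 mxE !eqxx mulr1.
have S'dl : dlsubmx S' = 0.
  by apply/matrixP => i j; rewrite !ord1 2!mxE S'0 mxE mulr0.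
have S'ur : ursubmx S' = 0 by rewrite -S'sym -trmx_dlsub S'dl trmx0.
have S'dr : (drsubmx S')^T = drsubmx S' by rewrite trmx_drsub S'sym.
have [U1 [h1 [U1o E1]]] := IH _ S'dr.
pose V : 'M[R]_(1 + n) := block_mx 1%:M 0 0 U1.
have VV : V^T *m V = 1%:M.
  rewrite /V tr_block_mx !trmx0 trmx1 mulmx_block !mulmx0 !mul0mx !addr0 !add0r.
  by rewrite mulmx1 U1o -scalar_mx_block.
have VDV : V^T *m diag_mx (row_mx a%:M h1) *m V = S'.
  rewrite -[RHS]submxK S'ul S'dl S'ur E1.
  rewrite /V tr_block_mx !trmx0 trmx1 diag_mx_row !mulmx_block.
  rewrite !mulmx0 !mul0mx !addr0 !add0r !mul0mx mulmx1 mul1mx.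
  congr block_mx.
  by apply/matrixP => i j; rewrite !ord1 !mxE.
exists (V *m H), (row_mx a%:M h1); split.
  by rewrite trmx_mul mulmxA -(mulmxA H^T) VV mulmx1.
have -> : S = H^T *m S' *m H.
  by rewrite /S' !mulmxA HH mul1mx -mulmxA HH mulmx1.
by rewrite -VDV trmx_mul !mulmxA.
Qed.

End Spectral.

(** * Nuclear and operator norms *)

Section Nuclear.
Context {R : realType}.

Lemma psd_diag n (S : 'M[R]_n) : psd S ->
  exists (U : 'M[R]_n) (h : 'rV[R]_n),
    [/\ U^T *m U = 1%:M, S = U^T *m diag_mx h *m U & forall i, 0 <= h 0 i].
Proof.
move=> [/sym_diag[U [h [U1 SE]]] S0]; exists U, h; split => // i.
have := S0 (U^T *m delta_mx i 0); rewrite dotvE fdot_mull trmxK SE.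
rewrite -!mulmxA (mulmxA U U^T) (mulmx1C U1) mul1mx (mulmxA U U^T) (mulmx1C U1).
rewrite mul1mx -[diag_mx h *m _]colE fdotE (bigD1 i)//= !big_ord1 !mxE !eqxx.
rewrite mul1r mulr1n big1 ?addr0// => j ji.
by rewrite big_ord1 !mxE (negbTE ji) mul0r.
Qed.

Lemma orthogonal_diag_mulmx n (U : 'M[R]_n) (g h : 'rV[R]_n) :
  U^T *m U = 1%:M ->
  (U^T *m diag_mx g *m U) *m (U^T *m diag_mx h *m U) =
  U^T *m diag_mx (\row_j (g 0 j * h 0 j)) *m U.
Proof.
move=> U1; rewrite !mulmxA -(mulmxA _ U U^T) (mulmx1C U1) mulmx1.
by rewrite -(mulmxA U^T) mulmx_diag.
Qed.

(** On positive semidefinite matrices the square root is never the default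
    value. *)
Lemma sqrtmx_psd n (S : 'M[R]_n) : psd S ->
  psd (sqrtmx S) /\ sqrtmx S *m sqrtmx S = S.
Proof.
move=> /psd_diag[U [h [U1 SE h0]]].
suff : [set Q : 'M[R]_n | psd Q /\ Q *m Q = S] !=set0 by exact: xgetPex.
pose g : 'rV[R]_n := \row_j Num.sqrt (h 0 j).
exists (U^T *m diag_mx g *m U); split; last first.
  rewrite orthogonal_diag_mulmx// SE; congr (_ *m diag_mx _ *m _).
  by apply/rowP => j; rewrite !mxE -expr2 sqr_sqrtr.
split; first by rewrite !trmx_mul trmxK tr_diag_mx mulmxA.
move=> x; rewrite dotvE -!mulmxA -fdot_mull fdotE.
apply: sumr_ge0 => i _; rewrite big_ord1 mul_diag_mx !mxE mulrCA -expr2.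
by rewrite mulr_ge0 ?sqr_ge0 ?sqrtr_ge0.
Qed.

Lemma gram_psd m n (M : 'M[R]_(m, n)) : psd (M^T *m M).
Proof.
split; first by rewrite trmx_mul trmxK.
by move=> x; rewrite dotvE -mulmxA -fdot_mull fdot_ge0.
Qed.

(** [opbound c V] says that the operator norm of V is at most c; stating it
    vector by vector avoids the supremum. *)
Definition opbound {m n : nat} (c : R) (V : 'M[R]_(m, n)) :=
  forall x : 'cV[R]_n, frobenius (V *m x) <= c * frobenius x.

Lemma opbound_opnorm m n (M : 'M[R]_(m, n)) : opbound (opnorm M) M.
Proof.
move=> x; have [x0|x0] := eqVneq (frobenius x) 0.
  have -> := frobenius_eq0 x0.
  by rewrite mulmx0 -(scale0r (0 : 'cV[R]_m)) -(scale0r (0 : 'cV[R]_n)) !frobeniusZ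
    normr0 !mul0r mulr0.
have xgt0 : 0 < frobenius x by rewrite lt_def x0 frobenius_ge0.
have [y [y1 ->]] : exists y, frobenius y = 1 /\ x = frobenius x *: y.
  exists ((frobenius x)^-1 *: x); rewrite scalerA divff// scale1r; split => //.
  by rewrite frobeniusZ normfV ger0_norm ?ltW// mulVf.
rewrite -scalemxAr !frobeniusZ mulrCA ler_wpM2l//.
rewrite y1 mulr1; apply: ub_le_sup; last by exists y => //=; rewrite y1.
exists (frobenius M) => _ [z /= z1 <-].
rewrite (le_trans (frobenius_mulmx_le _ _))//.
by rewrite -[leRHS]mulr1 ler_wpM2l ?frobenius_ge0.
Qed.

Lemma opbound_mulmx m n p (c : R) (V : 'M[R]_(m, n)) (N : 'M[R]_(n, p)) :
  0 <= c -> opbound c V -> frobenius (V *m N) <= c * frobenius N.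
Proof.
move=> c0 Vc; rewrite -(@ler_pXn2r _ 2)// ?nnegrE ?mulr_ge0 ?frobenius_ge0//.
rewrite exprMn -[X in _ * frobenius X ^+ 2]mul1mx !frobenius2_col mulr_sumr.
apply: ler_sum => j _; rewrite mul1mx -exprMn.
by rewrite ler_pXn2r// ?nnegrE ?mulr_ge0 ?frobenius_ge0.
Qed.

Lemma opbound_tr m n (c : R) (V : 'M[R]_(m, n)) :
  0 <= c -> opbound c V -> opbound c V^T.
Proof.
move=> c0 Vc y; have [->|x0] := eqVneq (frobenius (V^T *m y)) 0.
  by rewrite mulr_ge0 ?frobenius_ge0.
have xgt0 : 0 < frobenius (V^T *m y) by rewrite lt_def x0 frobenius_ge0.
rewrite -(ler_pM2l xgt0) -expr2 frobenius2 fdot_mull trmxK.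
apply: (le_trans (fdot_le _ _)); have := Vc (V^T *m y).
have := frobenius_ge0 y; nra.
Qed.

Lemma mulmx_opbound m n p (c : R) (V : 'M[R]_(n, p)) (N : 'M[R]_(m, n)) :
  0 <= c -> opbound c V -> frobenius (N *m V) <= c * frobenius N.
Proof.
have frobT k l (M : 'M[R]_(k, l)) : frobenius M^T = frobenius M.
  congr (Num.sqrt _); rewrite exchange_big/=.
  by apply: eq_bigr => i _; apply: eq_bigr => j _; rewrite mxE.
move=> c0 Vc; rewrite -frobT trmx_mul -(frobT _ _ N).
by apply: opbound_mulmx => //; exact: opbound_tr.
Qed.

(** Here and below a pair of hypotheses [P^T = P] and [P *m P = P] expresses
    that P is an orthogonal projection. *)
Lemma projection_pythagoras n p (P : 'M[R]_n) (M : 'M[R]_(n, p)) :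
  P^T = P -> P *m P = P ->
  frobenius M ^+ 2 = frobenius (P *m M) ^+ 2 + frobenius ((1%:M - P) *m M) ^+ 2.
Proof.
move=> PT PP; rewrite mulmxBl mul1mx !frobenius2 !fdot_lin (fdotC M).
by rewrite fdot_mull PT mulmxA PP fdot_mull PT; ring.
Qed.

Lemma projection_opbound n (P : 'M[R]_n) :
  P^T = P -> P *m P = P -> opbound 1 P.
Proof.
move=> PT PP x; rewrite mul1r -(@ler_pXn2r _ 2)// ?nnegrE ?frobenius_ge0//.
by rewrite [leRHS](projection_pythagoras x PT PP) lerDl sqr_ge0.
Qed.

Lemma projectionC n (P : 'M[R]_n) : P^T = P -> P *m P = P ->
  (1%:M - P)^T = 1%:M - P /\ (1%:M - P) *m (1%:M - P) = 1%:M - P.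
Proof.
move=> PT PP; split; first by rewrite raddfB/= trmx1 PT.
by rewrite mulmxBl mul1mx mulmxBr PP mulmx1 subrr subr0.
Qed.

Lemma trace_idempotent n (P : 'M[R]_n) : P *m P = P -> \tr P = (\rank P)%:R.
Proof.
move=> PP; rewrite -[in LHS](mulmx_base P) mxtrace_mulC.
suff -> : row_base P *m col_base P = 1%:M by rewrite mxtrace1.
apply: (row_full_inj (col_base_full P)).
apply: (row_free_inj (row_base_free P)); rewrite /= mulmx1.
by rewrite mulmxA mulmx_base -mulmxA mulmx_base PP.
Qed.

(** A right singular basis of M (the rows of U), with the singular values h. *)
Lemma nuclear_diag m n (M : 'M[R]_(m, n)) :
  exists (U : 'M[R]_n) (h : 'rV[R]_n),
    [/\ U^T *m U = 1%:M, forall i, 0 <= h 0 i,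
        M^T *m M = U^T *m diag_mx (\row_j (h 0 j * h 0 j)) *m U &
        nuclear M = \sum_i h 0 i].
Proof.
have [/psd_diag[U [h [U1 HE h0]]] H2] := sqrtmx_psd (gram_psd M).
exists U, h; split => //; first by rewrite -H2 HE orthogonal_diag_mulmx.
rewrite /nuclear HE mxtrace_mulC mulmxA (mulmx1C U1) mul1mx.
by apply: eq_bigr => i _; rewrite mxE eqxx mulr1n.
Qed.

Lemma frobenius2_gram m n (M : 'M[R]_(m, n)) j :
  frobenius (col j M) ^+ 2 = (M^T *m M) j j.
Proof.
rewrite frobenius2 fdotE mxE.
by apply: eq_bigr => i _; rewrite big_ord1 !mxE.
Qed.

(** Duality of the nuclear and operator norms: in a right singular basis u of M,
    <M, V> is the sum of the <M u_j, V u_j>, each at most h_j. *)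
Lemma fdot_le_nuclear m n (M V : 'M[R]_(m, n)) :
  opbound 1 V -> fdot M V <= nuclear M.
Proof.
move=> V1; have [U [h [U1 h0 ME ->]]] := nuclear_diag M.
have -> : fdot M V = fdot (M *m U^T) (V *m U^T).
  by rewrite fdot_mulr trmxK -mulmxA U1 mulmx1.
rewrite fdotE exchange_big/=; apply: ler_sum => j _.
have -> : \sum_i (M *m U^T) i j * (V *m U^T) i j =
          fdot (col j (M *m U^T)) (col j (V *m U^T)).
  by rewrite fdotE; apply: eq_bigr => i _; rewrite big_ord1 !mxE.
apply: (le_trans (fdot_le _ _)).
have -> : frobenius (col j (M *m U^T)) = h 0 j.
  apply/eqP; rewrite -(@eqrXn2 _ 2) ?frobenius_ge0//; apply/eqP.
  rewrite frobenius2_gram trmx_mul trmxK mulmxA -(mulmxA U) ME.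
  rewrite !mulmxA (mulmx1C U1) mul1mx -mulmxA (mulmx1C U1) mulmx1.
  by rewrite !mxE eqxx mulr1n expr2.
rewrite -[leRHS]mulr1 ler_wpM2l// colE -mulmxA (le_trans (V1 _))// mul1r.
rewrite -colE -(@ler_pXn2r _ 2)// ?nnegrE ?frobenius_ge0//.
by rewrite frobenius2_gram trmxK (mulmx1C U1) mxE eqxx expr1n.
Qed.

(** The polar factor of N: a partial isometry Q whose range contains that of N,
    which attains the nuclear norm of N and whose rank, the square of its
    Frobenius norm, is at most that of N. *)
Lemma nuclear_polar m n (N : 'M[R]_(m, n)) :
  exists Q : 'M[R]_(m, n),
    [/\ Q *m Q^T *m Q = Q, Q *m Q^T *m N = N, fdot N Q = nuclear N &
        frobenius Q ^+ 2 <= (\rank N)%:R].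
Proof.
have [U [h [U1 h0 NN ->]]] := nuclear_diag N.
pose D (g : 'rV[R]_n) := U^T *m diag_mx g *m U.
have DD g g' : D g *m D g' = D (\row_j (g 0 j * g' 0 j)).
  exact: orthogonal_diag_mulmx.
have DT g : (D g)^T = D g by rewrite !trmx_mul trmxK tr_diag_mx mulmxA.
have trD g : \tr (D g) = \sum_i g 0 i.
  rewrite mxtrace_mulC mulmxA (mulmx1C U1) mul1mx.
  by apply: eq_bigr => i _; rewrite mxE eqxx mulr1n.
rewrite -/(D _) in NN; clearbody D.
(* D k is the pseudo-inverse of the square root D h, as 0^-1 = 0; D p is the
   projection onto the row space of N. *)
pose k : 'rV[R]_n := \row_j (h 0 j)^-1.
pose p : 'rV[R]_n := \row_j (h 0 j * (h 0 j)^-1).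
have hV j : h 0 j * h 0 j * (h 0 j)^-1 = h 0 j.
  by have [->|hj] := eqVneq (h 0 j) 0; [rewrite !mul0r|rewrite mulfK].
have hVV j : h 0 j * (h 0 j)^-1 * (h 0 j)^-1 = (h 0 j)^-1.
  by have [->|hj] := eqVneq (h 0 j) 0; [rewrite invr0 !mulr0|rewrite divff// mul1r].
pose Q := N *m D k.
have QQ : Q^T *m Q = D p.
  rewrite /Q trmx_mul DT -!mulmxA (mulmxA N^T) NN !DD.
  by congr (D _); apply/rowP => j; rewrite !mxE hV mulrC.
have Np : N *m D p = N.
  have N1 : fdot N (N *m D p) = fdot N N.
    rewrite /fdot mulmxA NN DD; congr (\tr (D _)).
    by apply/rowP => j; rewrite !mxE mulrA mulrAC hV.
  have N2 : fdot (N *m D p) (N *m D p) = fdot N (N *m D p).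
    rewrite fdot_mulr DT -mulmxA DD; congr (fdot _ (_ *m D _)).
    by apply/rowP => j; rewrite !mxE mulrA (mulrAC (h 0 j)) hV.
  apply/eqP; rewrite -subr_eq0; apply/eqP/fdot_eq0.
  by rewrite !fdot_lin (fdotC _ N) N2 N1; ring.
have QE : Q *m D h = N.
  rewrite -[RHS]Np /Q -mulmxA DD; congr (_ *m D _).
  by apply/rowP => j; rewrite !mxE mulrC.
have QQQ : Q *m Q^T *m Q = Q.
  rewrite -mulmxA QQ /Q -mulmxA DD; congr (_ *m D _).
  by apply/rowP => j; rewrite !mxE mulrC hVV.
exists Q; split => //.
- by rewrite -{1}QE mulmxA QQQ QE.
- rewrite /fdot /Q mulmxA NN DD trD.
  by apply: eq_bigr => j _; rewrite !mxE hV.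
- rewrite frobenius2 /fdot QQ trace_idempotent.
    by rewrite ler_nat -QQ (leq_trans (mxrankM_maxr _ _))// mxrankM_maxl.
  by rewrite -QQ mulmxA -(mulmxA Q^T) -mulmxA QQQ.
Qed.

End Nuclear.

(** * Deterministic oracle inequality *)

Section Oracle.
Context {R : realType}.

(** The penalty dominates the noise up to a term of rank type: V = Q - W / l
    below is a subgradient of the nuclear norm at N, chosen to cancel the part of
    Z that is orthogonal to the row and column spaces of N. *)
Lemma nuclear_noise_le m n (l : R) (N M Z : 'M[R]_(m, n)) :
  0 < l -> opbound (l / 2) Z ->
  l * (nuclear N - nuclear M) - fdot (M - N) Z <=
  2 * l * Num.sqrt (\rank N)%:R * frobenius (M - N).
Proof.
move=> l0 Zl; have l20 : 0 <= l / 2 by rewrite ltW// divr_gt0.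
have [Q [QQQ QN NQ rQ]] := nuclear_polar N.
have [P1 P1E] : exists P1, P1 = Q *m Q^T by eexists.
have [P2 P2E] : exists P2, P2 = Q^T *m Q by eexists.
have P1T : P1^T = P1 by rewrite P1E trmx_mul trmxK.
have P2T : P2^T = P2 by rewrite P2E trmx_mul trmxK.
have P1Q : P1 *m Q = Q by rewrite P1E.
have QP2 : Q *m P2 = Q by rewrite P2E mulmxA.
have QtP1 : Q^T *m P1 = Q^T by rewrite -{1}P1T -trmx_mul P1Q.
have PP1 : P1 *m P1 = P1 by rewrite {2}P1E mulmxA P1Q -P1E.
have PP2 : P2 *m P2 = P2 by rewrite {1}P2E -mulmxA QP2 -P2E.
have [S1T SS1] := projectionC P1T PP1.
have [S2T SS2] := projectionC P2T PP2.
have P2b := projection_opbound P2T PP2.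
have S1b := projection_opbound S1T SS1.
have S2b := projection_opbound S2T SS2.
have [W WE] : exists W, W = (1%:M - P1) *m Z *m (1%:M - P2) by eexists.
have Wb : opbound (l / 2) W.
  move=> x; rewrite WE -!mulmxA (le_trans (S1b _))// mul1r (le_trans (Zl _))//.
  by rewrite ler_wpM2l// (le_trans (S2b _))// mul1r.
have WS2 : W *m (1%:M - P2) = W by rewrite WE -mulmxA SS2.
have QtW : Q^T *m W = 0.
  by rewrite WE 2!(mulmxA Q^T) (mulmxBr Q^T) mulmx1 QtP1 subrr !mul0mx.
have Qb : opbound 1 Q.
  move=> x; rewrite mul1r -(@ler_pXn2r _ 2)// ?nnegrE ?frobenius_ge0//.
  rewrite frobenius2 fdot_mull mulmxA -P2E -PP2 -mulmxA -{1}P2T -fdot_mull.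
  rewrite -frobenius2 ler_pXn2r// ?nnegrE ?frobenius_ge0//.
  by rewrite -[leRHS]mul1r P2b.
pose V := Q - l^-1 *: W.
have Vb : opbound 1 V.
  move=> x; rewrite mul1r -(@ler_pXn2r _ 2)// ?nnegrE ?frobenius_ge0//.
  rewrite [leRHS](projection_pythagoras x P2T PP2).
  (* the two terms are orthogonal, since Q^T W = 0 *)
  have -> : V *m x = Q *m (P2 *m x) - l^-1 *: (W *m ((1%:M - P2) *m x)).
    by rewrite !(mulmxA _ _ x) QP2 WS2 /V mulmxBl scalemxAl.
  move: (P2 *m x) ((1%:M - P2) *m x) => y z.
  rewrite [leLHS]frobenius2 !fdot_lin (fdotC (W *m z)).
  have -> : fdot (Q *m y) (W *m z) = 0.
    by rewrite fdot_mull mulmxA QtW mul0mx /fdot mulmx0 mxtrace0.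
  rewrite -!frobenius2.
  have := Qb y; have := Wb z; rewrite mul1r.
  have := frobenius_ge0 z; have := frobenius_ge0 (W *m z).
  have := frobenius_ge0 (Q *m y); have := frobenius_ge0 y.
  move: (frobenius y) (frobenius (Q *m y)) (frobenius z) (frobenius (W *m z)).
  move=> a b c e a0 b0 e0 c0 ec ba.
  have lec : l^-1 * e <= c.
    by rewrite ler_pdivrMl// (le_trans ec)// ler_wpM2r//; lra.
  have le0 : 0 <= l^-1 * e by rewrite mulr_ge0// invr_ge0 ltW.
  rewrite [leLHS](_ : _ = b ^+ 2 + (l^-1 * e) ^+ 2); last by ring.
  nra.
have NW : fdot N W = 0.
  by rewrite -QN -P1E fdot_mull P1T P1E -mulmxA QtW mulmx0 /fdot mulmx0 mxtrace0.
have MV := fdot_le_nuclear M Vb.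
have -> : 2 * l * Num.sqrt (\rank N)%:R * frobenius (M - N) =
   frobenius (M - N) * (l * Num.sqrt (\rank N)%:R
     + (l / 2 * Num.sqrt (\rank N)%:R + l / 2 * Num.sqrt (\rank N)%:R)).
  by field.
have Zdec : Z - W = P1 *m Z + (1%:M - P1) *m Z *m P2.
  rewrite WE mulmxBr mulmx1 mulmxBl mul1mx.
  by rewrite opprD opprK addrA opprB addrCA subrr addr0.
have Qr : frobenius Q <= Num.sqrt (\rank N)%:R.
  by rewrite -[leLHS]ger0_norm ?frobenius_ge0// -sqrtr_sqr ler_wsqrtr.
have P1f : frobenius P1 <= frobenius Q.
  by rewrite P1E -[leRHS]mul1r mulmx_opbound//; apply: opbound_tr.
have P2f : frobenius P2 <= frobenius Q.
  by rewrite P2E -[leRHS]mul1r opbound_mulmx//; apply: opbound_tr.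
(* <M, V> <= |M| and <N, V> = <N, Q> = |N| in nuclear norm *)
apply: (@le_trans _ _ (fdot (- (M - N)) (l *: Q + (Z - W)))).
  rewrite fdotNl !fdot_lin NW NQ.
  have : l * fdot M V <= l * nuclear M by rewrite ler_pM2l.
  rewrite /V !fdot_lin mulrBr mulrA divff ?gt_eqF// mul1r => h.
  lra.
apply: (le_trans (fdot_le _ _)); rewrite frobeniusN ler_wpM2l ?frobenius_ge0//.
apply: (le_trans (ler_frobeniusD _ _)); apply: lerD.
  by rewrite frobeniusZ gtr0_norm// ler_pM2l.
rewrite Zdec (le_trans (ler_frobeniusD _ _))//; apply: lerD.
  apply: (@le_trans _ _ (l / 2 * frobenius P1)); first exact: mulmx_opbound.
  by rewrite ler_wpM2l// (le_trans P1f).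
rewrite -mulmxA (le_trans (opbound_mulmx _ _ S1b))// mul1r.
apply: (le_trans (opbound_mulmx _ _ Zl)) => //.
by rewrite ler_wpM2l// (le_trans P2f).
Qed.

(** [Nh] need only beat the competitor N, not minimize F. *)
Lemma nuclear_oracle m n (l : R) (N0 N Nh Z U : 'M[R]_(m, n)) :
  0 < l -> opbound (l / 2) Z ->
  let F M := frobenius (M - N0) ^+ 2 / 2 + fdot M Z + fdot M U + l * nuclear M in
  F Nh <= F N ->
  frobenius (Nh - N0) ^+ 2 <= 4 * frobenius (N - N0) ^+ 2
    + 48 * l ^+ 2 * (\rank N)%:R + 12 * frobenius U ^+ 2.
Proof.
move=> l0 Zl F; rewrite /F => {F} FF.
have := nuclear_noise_le N Nh l0 Zl.
have : fdot (N - Nh) U <= frobenius (N - Nh) * frobenius U by exact: fdot_le.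
have : frobenius (Nh - N) <= frobenius (Nh - N0) + frobenius (N - N0).
  rewrite (_ : Nh - N = (Nh - N0) - (N - N0)); last first.
    by rewrite opprB addrA subrK.
  by rewrite (le_trans (ler_frobeniusD _ _))// frobeniusN.
rewrite -(frobeniusN (N - Nh)) opprB !fdot_lin.
have s2 : Num.sqrt (\rank N)%:R ^+ 2 = (\rank N)%:R :> R.
  by rewrite sqr_sqrtr// ler0n.
rewrite -s2; move: (sqrtr_ge0 (\rank N)%:R : 0 <= Num.sqrt _ :> R).
move: FF {s2}; have := frobenius_ge0 U; have := frobenius_ge0 (Nh - N).
have := frobenius_ge0 (Nh - N0); have := frobenius_ge0 (N - N0).
move: (frobenius (Nh - N0)) (frobenius (N - N0)) (frobenius U) (frobenius (Nh - N)).
move: (Num.sqrt _) (fdot _ _) (fdot _ _) (fdot _ _) (fdot _ _) (nuclear _) (nuclear _).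
(* x = |Nh - N0|, a = |N - N0|, u = |U|, dl = |Nh - N|, s = sqrt (rank N) *)
move=> s f1 f2 f3 f4 n1 n2 x a u dl a0 x0 d0 u0 FF s0 h1 h2 h3.
rewrite sqrtr_sqr ger0_norm// in h3.
have k0 : 0 <= 2 * l * s + u by rewrite addr_ge0// !mulr_ge0// ltW.
have h4 : x ^+ 2 <= a ^+ 2 + 2 * (2 * l * s + u) * dl by lra.
have h5 : x ^+ 2 <= a ^+ 2 + 2 * (2 * l * s + u) * (x + a) by nra.
have h6 : (2 * l * s + u) ^+ 2 <= 8 * l ^+ 2 * s ^+ 2 + 2 * u ^+ 2.
  by have := sqr_ge0 (2 * l * s - u); nra.
(* 2 k x <= x^2 / 2 + 2 k^2 and 2 k a <= a^2 + k^2 *)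
move: (2 * l * s + u) h5 h6 => k h5 h6.
by have := sqr_ge0 (x - 2 * k); have := sqr_ge0 (a - k); nra.
Qed.

End Oracle.

(** * Integrals of continuous functions on [0, T] *)

Section PathIntegrals.
Context {R : realType} (T : R).
Notation mu := (@lebesgue_measure R).
(** Continuity of a real function on [0, T], one-sided at the end points. *)
Notation "f \is_cts" := ({within `[0, T], continuous (f : R -> R)})
  (at level 10, only parsing).

Lemma cts_mul (f g : R -> R) : f \is_cts -> g \is_cts -> (fun t => f t * g t) \is_cts.
Proof. by move=> cf cg x; apply: cvgM; [exact: cf|exact: cg]. Qed.

Lemma cts_cst (c : R) : (fun=> c) \is_cts.
Proof. by move=> x; exact: cvg_cst. Qed.

Lemma cts_sum (I : Type) (s : seq I) (f : I -> R -> R) :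
  (forall i, (f i) \is_cts) -> (fun t => \sum_(i <- s) f i t) \is_cts.
Proof.
move=> cf; elim: s => [|i s IH].
  have -> : (fun t => \sum_(i <- [::]) f i t) = fun=> 0.
    by apply/funext => t; rewrite big_nil.
  exact: cts_cst.
have -> : (fun t => \sum_(j <- i :: s) f j t) =
          (fun t => f i t + \sum_(j <- s) f j t).
  by apply/funext => t; rewrite big_cons.
by move=> x; apply: cvgD; [exact: cf|exact: IH].
Qed.

Lemma cts_integrable (f : R -> R) (D : set R) : measurable D ->
  D `<=` `[0, T] -> f \is_cts -> mu.-integrable D (EFin \o f).
Proof.
move=> mD DT cf; apply: (@integrableS _ _ _ mu `[0, T]) => //.
by apply: continuous_compact_integrable => //; exact: segment_compact.
Qed.

Lemma Rintegral_cts_sum (I : Type) (s : seq I) (f : I -> R -> R) :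
  (forall i, (f i) \is_cts) ->
  \int[mu]_(t in `[0, T]) (\sum_(i <- s) f i t) =
  \sum_(i <- s) \int[mu]_(t in `[0, T]) f i t.
Proof.
move=> cf; elim: s => [|i s IH].
  under eq_Rintegral do rewrite big_nil.
  by rewrite big_nil Rintegral_cst// mul0r.
under eq_Rintegral do rewrite big_cons.
rewrite big_cons RintegralD ?IH//; apply: cts_integrable => //.
exact: cts_sum.
Qed.

(** Uniform continuity on [0, T], from the near-covering form of compactness. *)
Lemma cts_unif (f : R -> R) e : 0 < e -> f \is_cts ->
  exists2 d : R, 0 < d & forall x y, x \in `[0, T] -> y \in `[0, T] ->
    `|x - y| < d -> `|f x - f y| < e.
Proof.
move=> e0 /subspace_continuousP cf.
have := @segment_compact R 0 T.
rewrite compact_near_coveringP -near_covering_withinP.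
move=> /(_ _ (0^'+) (fun d x => forall y, y \in `[0, T] -> `|x - y| < d ->
  `|f x - f y| < e)) [].
- move=> x xT.
  have e20 : 0 < e / 2 by rewrite divr_gt0.
  have /cvgrPdist_lt/(_ _ e20) := cf x xT.
  rewrite near_withinE => /nbhs_ballP[d/= d0 fd].
  have d20 : 0 < d / 2 by rewrite divr_gt0.
  near=> x' d'; rewrite /= => x'T y yT xy.
  have xx' : `|x - x'| < d / 2.
    by near: x'; exact: (nbhsx_ballx x _ d20).
  have dd' : d' < d / 2 by near: d'; exact: nbhs_right_lt.
  have h1 : `|f x - f x'| < e / 2.
    by apply: fd => //=; rewrite /ball/= (lt_trans xx')// gtr_pMr// invf_lt1// ltr1n.
  have h2 : `|f x - f y| < e / 2.
    apply: fd => //=; rewrite /ball/= (splitr d).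
    by rewrite -(subrKA x') (le_lt_trans (ler_normD _ _))// ltrD// (lt_trans xy).
  rewrite -(subrKA (f x)) (le_lt_trans (ler_normD _ _))// (splitr e) ltrD//.
  by rewrite distrC.
- move=> d /= d0 fd; have d20 : 0 < d / 2 by rewrite divr_gt0.
  exists (d / 2) => // x y xT yT; apply: (fd (d / 2) _ d20 x xT y yT).
  by rewrite /= sub0r normrN gtr0_norm// gtr_pMr// invf_lt1// ltr1n.
Unshelve. all: by end_near. Qed.

Lemma cts_bounded (f : R -> R) : f \is_cts ->
  exists2 M : R, 0 < M & forall x, x \in `[0, T] -> `|f x| <= M.
Proof.
move=> cf; have [T0|T0] := leP 0 T; last first.
  exists 1 => // x; rewrite in_itv/= => /andP[x0 xT].
  by have := le_trans x0 xT; rewrite leNgt T0.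
have cnf : (fun t => `|f t|) \is_cts by move=> x; apply: cvg_norm; exact: cf.
have [c cT fc] := EVT_max T0 cnf.
exists (`|f c| + 1) => [|x /fc fx]; first by rewrite ltr_wpDl.
by rewrite (le_trans fx)// lerDl.
Qed.

(** The error of the left-endpoint rule for the integral of f against the
    primitive of g, over one interval [a, b] of a subdivision. *)
Lemma riemann_step (f g : R -> R) (e M a b : R) :
  f \is_cts -> g \is_cts -> 0 <= e -> 0 <= a -> a <= b -> b <= T ->
  (forall t, t \in `[0, T] -> `|g t| <= M) ->
  (forall t, t \in `]a, b] -> `|f a - f t| <= e) ->
  `|f a * (\int[mu]_(t in `[0, b]) g t - \int[mu]_(t in `[0, a]) g t) -
    (\int[mu]_(t in `[0, b]) (f t * g t) - \int[mu]_(t in `[0, a]) (f t * g t))|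
  <= e * M * (b - a).
Proof.
move=> cf cg e0 a0 ab bT gM fe.
have sub0b : `[0, b] `<=` `[0, T].
  by move=> t /=; rewrite !in_itv/= => /andP[-> /le_trans->].
have subab : `]a, b] `<=` `[0, T].
  move=> t /=; rewrite !in_itv/= => /andP[a_t /le_trans->//].
  by rewrite (le_trans a0)// ltW.
have cfg := cts_mul cf cg.
rewrite !Rintegral_itvB ?bnd_simp//; [|exact: cts_integrable..].
rewrite -RintegralZl//; last exact: cts_integrable.
have caf : (fun t => f a * g t - f t * g t) \is_cts.
  by move=> x; apply: cvgB; [apply: cvgM; [exact: cvg_cst|exact: cg]|exact: cfg].
have iD := cts_integrable (measurable_itv _) subab caf.
have iag := cts_integrable (measurable_itv _) subab (cts_mul (@cts_cst (f a)) cg).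
rewrite -RintegralB//; last exact: cts_integrable.
apply: (le_trans (le_normr_Rintegral _ iD)) => //.
have -> : e * M * (b - a) = \int[mu]_(t in `]a, b]) (e * M).
  rewrite Rintegral_cst//= lebesgue_measure_itv/= lte_fin.
  by move: ab; rewrite le_eqVlt => /predU1P[->|->//]; rewrite ltxx subrr.
apply: le_Rintegral => //.
- exact: integrable_norm.
- by apply: cts_integrable => //; exact: cts_cst.
- move=> t tab; rewrite -mulrBl normrM ler_pM//; first exact: fe.
  exact/gM/subab.
Qed.

End PathIntegrals.

(** * Riemann sums along uniform subdivisions *)

Section UniformSubdivision.
Context {R : realType} (T : R).
Hypothesis T_gt0 : 0 < T.
Notation mu := (@lebesgue_measure R).
Notation "f \is_cts" := ({within `[0, T], continuous (f : R -> R)})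
  (at level 10, only parsing).

(** The k-th point of the subdivision of [0, T] into n + 1 equal intervals. *)
Definition upoint (n k : nat) : R := T * (k%:R / n.+1%:R).

(** That subdivision without its first point 0, as [itv_partition] and
    [riemann_sum] expect. *)
Definition usubdiv (n : nat) : seq R :=
  [seq upoint n k.+1 | k <- iota 0 n.+1].

Lemma size_usubdiv n : size (usubdiv n) = n.+1.
Proof. by rewrite size_map size_iota. Qed.

Lemma upoint0 n : upoint n 0 = 0.
Proof. by rewrite /upoint mul0r mulr0. Qed.

Lemma upointT n : upoint n n.+1 = T.
Proof. by rewrite /upoint divff ?mulr1// pnatr_eq0. Qed.

Lemma upointB n k : upoint n k.+1 - upoint n k = T / n.+1%:R.
Proof. by rewrite /upoint -mulrBr -mulrBl -natr1 addrAC subrr add0r mul1r. Qed.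

Lemma le_upoint n : {homo upoint n : k l / (k <= l)%N >-> k <= l}.
Proof.
move=> k l kl; rewrite /upoint ler_pM2l// ler_pM2r ?invr_gt0 ?ltr0n//.
by rewrite ler_nat.
Qed.

Lemma upoint_in n k : (k <= n.+1)%N -> 0 <= upoint n k <= T.
Proof.
move=> kn; apply/andP; split; first by rewrite -(upoint0 n) le_upoint.
by rewrite -[leRHS](upointT n) le_upoint.
Qed.

Lemma nth_usubdiv n k : (k < n.+1)%N -> nth T (usubdiv n) k = upoint n k.+1.
Proof. by move=> kn; rewrite (nth_map 0%N) ?size_iota// nth_iota. Qed.

Lemma nth_usubdiv0 n k :
  (k < n.+1)%N -> nth T (0 :: usubdiv n) k = upoint n k.
Proof. by case: k => [_|k /ltnW kn]; rewrite ?upoint0//= nth_usubdiv. Qed.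

Lemma usubdiv_partition n : itv_partition 0 T (usubdiv n).
Proof.
split.
  apply/(pathP T) => k; rewrite size_usubdiv => kn.
  rewrite nth_usubdiv0// nth_usubdiv// -subr_gt0 upointB.
  by rewrite divr_gt0// ltr0n.
by rewrite (last_nth T) size_usubdiv/= nth_usubdiv// upointT.
Qed.

Lemma near_upoint d : 0 < d ->
  \forall n \near \oo, forall k, upoint n k.+1 - upoint n k < d.
Proof.
move=> d0; near=> n => k; rewrite upointB.
rewrite ltr_pdivrMr ?ltr0n// mulrC -ltr_pdivrMr//.
have : d^-1 * T < n%:R by near: n; exact: nbhs_infty_gtr.
by rewrite mulrC => /lt_trans->//; rewrite ltr_nat.
Unshelve. all: by end_near. Qed.

Lemma riemann_cvg (f g : R -> R) : f \is_cts -> g \is_cts ->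
  (fun n => \sum_(k < n.+1) f (upoint n k) *
     (\int[mu]_(t in `[0, upoint n k.+1]) g t -
      \int[mu]_(t in `[0, upoint n k]) g t)) @ \oo -->
  \int[mu]_(t in `[0, T]) (f t * g t).
Proof.
move=> cf cg; apply/cvgrPdist_le => e e0.
have [M M0 gM] := cts_bounded cg.
have e'0 : 0 < e / (M * T) by rewrite divr_gt0// mulr_gt0.
(* the n + 1 errors add up to (e / (M T)) M T = e *)
have [d d0 fd] := cts_unif e'0 cf.
near=> n.
have step k : upoint n k.+1 - upoint n k < d.
  by move: k; near: n; exact: near_upoint.
rewrite distrC.
have -> : \int[mu]_(t in `[0, T]) (f t * g t) = \sum_(k < n.+1)
    (\int[mu]_(t in `[0, upoint n k.+1]) (f t * g t) -
     \int[mu]_(t in `[0, upoint n k]) (f t * g t)).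
  rewrite -(big_mkord xpredT (fun k =>
    \int[mu]_(t in `[0, upoint n k.+1]) (f t * g t) -
    \int[mu]_(t in `[0, upoint n k]) (f t * g t))).
  rewrite telescope_sumr// upointT upoint0 set_itv1.
  by rewrite Rintegral_set1 subr0.
rewrite -sumrB; apply: (le_trans (ler_norm_sum _ _ _)).
apply: (@le_trans _ _ (\sum_(k < n.+1) e / (M * T) * M * (T / n.+1%:R))).
  apply: ler_sum => k _.
  have /andP[t0 _] := upoint_in (ltnW (ltn_ord k)).
  have /andP[_ tT] := upoint_in (ltn_ord k).
  have tt : upoint n k <= upoint n k.+1 by exact: le_upoint.
  rewrite -(upointB n k); apply: riemann_step => //; first exact: ltW.
  move=> t /[!in_itv]/= /andP[kt tk]; apply/ltW/fd.
  - by rewrite in_itv/= t0 (le_trans tt).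
  - by rewrite in_itv/= (le_trans t0 (ltW kt)) (le_trans tk).
  - rewrite distrC gtr0_norm ?subr_gt0//.
    by rewrite (le_lt_trans _ (step k))// lerD2r.
rewrite sumr_const card_ord -mulr_natl.
rewrite le_eqVlt; apply/orP; left; apply/eqP; field.
by rewrite !gt_eqF//= -natr1 -?natr1 ?ltr_wpDl.
Unshelve. all: by end_near. Qed.

Lemma riemann_sum_usubdiv d n (H Y : R -> 'cV[R]_d) :
  riemann_sum T (usubdiv n) H Y = \sum_(k < n.+1)
    dotv (H (upoint n k)) (Y (upoint n k.+1) - Y (upoint n k)).
Proof.
rewrite /riemann_sum size_usubdiv; apply: eq_bigr => k _.
by rewrite nth_usubdiv0// nth_usubdiv.
Qed.

End UniformSubdivision.

(** * Convergence in probability *)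

Section ConvergenceInProbability.
Context {R : realType} {disp : measure_display} {Omega : measurableType disp}.
Variable P : probability Omega R.

(** The sequence Z converges to K in probability. *)
Definition cvg_prob (Z : nat -> Omega -> R) (K : Omega -> R) :=
  forall e p : R, 0 < e -> 0 < p ->
    \forall n \near \oo, (P [set w | (e <= `|Z n w - K w|)%R] <= p%:E)%E.

Lemma measurable_ge_norm (f : Omega -> R) e : measurable_fun setT f ->
  measurable [set w | e <= `|f w|].
Proof.
move=> mf; have mnf : measurable_fun setT (fun w => `|f w|).
  exact: measurableT_comp.
have := mnf measurableT `[e, +oo[%classic (measurable_itv _).
rewrite setTI; congr measurable; apply/seteqP.
by split => w /=; rewrite in_itv/= andbT.
Qed.

Lemma cvg_probD (Z Z' : nat -> Omega -> R) (K K' : Omega -> R) :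
  (forall n, measurable_fun setT (Z n)) -> (forall n, measurable_fun setT (Z' n)) ->
  measurable_fun setT K -> measurable_fun setT K' ->
  cvg_prob Z K -> cvg_prob Z' K' ->
  cvg_prob (fun n w => Z n w + Z' n w) (fun w => K w + K' w).
Proof.
move=> mZ mZ' mK mK' ZK ZK' e p e0 p0.
have e20 : 0 < e / 2 by rewrite divr_gt0.
have p20 : 0 < p / 2 by rewrite divr_gt0.
near=> n.
have h1 : (P [set w | (e / 2 <= `|Z n w - K w|)%R] <= (p / 2)%:E)%E.
  by near: n; exact: ZK.
have h2 : (P [set w | (e / 2 <= `|Z' n w - K' w|)%R] <= (p / 2)%:E)%E.
  by near: n; exact: ZK'.
have m1 : measurable [set w | e / 2 <= `|Z n w - K w|].
  by apply: measurable_ge_norm; exact: measurable_funB.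
have m2 : measurable [set w | e / 2 <= `|Z' n w - K' w|].
  by apply: measurable_ge_norm; exact: measurable_funB.
rewrite [p]splitr EFinD (le_trans _ (leeD h1 h2))//.
apply: (@le_trans _ _ (P ([set w | e / 2 <= `|Z n w - K w|] `|`
  [set w | e / 2 <= `|Z' n w - K' w|]))); last exact: measureU2.
apply: le_measure.
- rewrite inE; apply: measurable_ge_norm.
  by apply: measurable_funB; exact: measurable_funD.
- by rewrite inE; exact: measurableU.
- move=> w /= ew; apply: contrapT => /not_orP[/negP + /negP].
  rewrite -!ltNge => h h'; move: ew; apply/negP; rewrite -ltNge (splitr e).
  by rewrite opprD addrACA (le_lt_trans (ler_normD _ _))// ltrD.
Unshelve. all: by end_near. Qed.

Lemma cvg_probZ (c : R) (Z : nat -> Omega -> R) (K : Omega -> R) :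
  cvg_prob Z K -> cvg_prob (fun n w => c * Z n w) (fun w => c * K w).
Proof.
move=> ZK e p e0 p0; have [->|c0] := eqVneq c 0.
  near=> n; rewrite (_ : [set w | _] = set0) ?measure0 ?lee_fin ?ltW//.
  apply/seteqP; split => w //=; rewrite !mul0r subrr normr0.
  by rewrite leNgt e0.
have c1 : 0 < `|c| by rewrite normr_gt0.
near=> n; rewrite (_ : [set w | _] = [set w | e / `|c| <= `|Z n w - K w|]).
  by near: n; apply: ZK => //; exact: divr_gt0.
apply/seteqP; split => w /=; rewrite -mulrBr normrM ler_pdivrMr// mulrC//.
Unshelve. all: by end_near. Qed.

Lemma cvg_prob_sum (I : Type) (s : seq I) (Z : I -> nat -> Omega -> R)
    (K : I -> Omega -> R) :
  (forall i n, measurable_fun setT (Z i n)) -> (forall i, measurable_fun setT (K i)) ->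
  (forall i, cvg_prob (Z i) (K i)) ->
  cvg_prob (fun n w => \sum_(i <- s) Z i n w) (fun w => \sum_(i <- s) K i w).
Proof.
move=> mZ mK ZK; elim: s => [|i s IH].
  move=> e p e0 p0; near=> n.
  rewrite (_ : [set w | _] = set0) ?measure0 ?lee_fin ?ltW//.
  apply/seteqP; split => w //=; rewrite !big_nil subrr normr0.
  by rewrite leNgt e0.
have -> : (fun n w => \sum_(j <- i :: s) Z j n w) =
          (fun n w => Z i n w + \sum_(j <- s) Z j n w).
  by apply/funext => n; apply/funext => w; rewrite big_cons.
have -> : (fun w => \sum_(j <- i :: s) K j w) =
          (fun w => K i w + \sum_(j <- s) K j w).
  by apply/funext => w; rewrite big_cons.
apply: cvg_probD => //.
- by move=> n; exact: measurable_sum.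
- exact: measurable_sum.
Unshelve. all: by end_near. Qed.

(** A limit in probability and an almost sure limit coincide almost surely.
    There is no need to extract a subsequence, nor for G to be measurable: for
    each m and N, the event that |Z_n - K| >= 1 / (m + 1) for all n >= N is
    null, being contained in events of arbitrarily small probability. *)
Lemma cvg_prob_ae_unique (Z : nat -> Omega -> R) (K G : Omega -> R) :
  (forall n, measurable_fun setT (Z n)) -> measurable_fun setT K ->
  cvg_prob Z K -> {ae P, forall w, Z ^~ w @ \oo --> G w} ->
  {ae P, forall w, K w = G w}.
Proof.
move=> mZ mK ZK ZG.
pose B m n := [set w | m.+1%:R^-1 <= `|Z n w - K w|].
have mB m n : measurable (B m n).
  by apply: measurable_ge_norm; exact: measurable_funB.
have bad m N : P.-negligible (\bigcap_(n in [set n | (N <= n)%N]) B m n).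
  apply/negligibleP; first exact: bigcap_measurableType.
  apply/eqP; rewrite eq_le measure_ge0 andbT; apply/lee_addgt0Pr => p p0.
  rewrite add0e.
  have := ZK m.+1%:R^-1 p; rewrite invr_gt0 ltr0n => /(_ isT p0)[k _ kP].
  apply: (le_trans _ (kP (maxn k N) (leq_maxl _ _))); apply: le_measure.
  - by rewrite inE; exact: bigcap_measurableType.
  - by rewrite inE; exact: mB.
  - by move=> w /(_ (maxn k N)); apply; exact: leq_maxr.
have good : {ae P, forall w, forall m N, ~ forall n, (N <= n)%N -> B m n w}.
  apply: ae_foralln => m; apply: ae_foralln => N.
  apply: negligibleS (bad m N) => w /= /contrapT h n /=; exact: h.
apply: filterS2 ZG good => w Zw gw; apply/eqP; rewrite -subr_eq0 -normr_le0.
apply/ler_addgt0Pr => e e0; rewrite add0r.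
have e20 : 0 < e / 2 by rewrite divr_gt0.
have [m me] : exists m, m.+1%:R^-1 <= e / 2.
  have [m /= mP] := filter_ex (nbhs_infty_gtr (e / 2)^-1).
  exists m; rewrite -[leRHS]invrK lef_pV2 ?posrE ?invr_gt0 ?ltr0n//.
  by rewrite (le_trans (ltW mP))// ler_nat.
have /cvgrPdist_le/(_ _ e20)[N _ NZ] := Zw.
have /existsNP[n /not_implyP[Nn /negP]] := gw m N.
rewrite -ltNge => h; rewrite -(subrKA (Z n w)) (le_trans (ler_normD _ _))//.
rewrite [e]splitr lerD//; first by rewrite distrC (le_trans (ltW h)).
by rewrite distrC NZ.
Qed.

End ConvergenceInProbability.

(** * The Ito integral of an Ornstein-Uhlenbeck process against itself *)

Section ItoField.
Context {R : realType} (T : R).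
Hypothesis T_gt0 : 0 < T.
Notation mu := (@lebesgue_measure R).
Notation "f \is_cts" := ({within `[0, T], continuous (f : R -> R)})
  (at level 10, only parsing).

Lemma cvg_sumr (I : Type) (s : seq I) (f : I -> nat -> R) (l : I -> R) :
  (forall i, f i @ \oo --> l i) ->
  (fun n => \sum_(i <- s) f i n) @ \oo --> \sum_(i <- s) l i.
Proof.
by move=> fl; apply: cvg_big => [|i _]; [exact: add_continuous|exact: fl].
Qed.

Lemma dotv_mulmx d (A B : 'M[R]_d) (x : 'cV[R]_d) :
  dotv (A *m x) (B *m x) =
  \sum_i \sum_j \sum_k (A i j * B i k) * (x j 0 * x k 0).
Proof.
apply: eq_bigr => i _; rewrite !mxE mulr_suml; apply: eq_bigr => j _.
by rewrite mulr_sumr; apply: eq_bigr => k _; ring.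
Qed.

Lemma cts_mulmx d (A : 'M[R]_d) (x : R -> 'cV[R]_d) i :
  (forall j, (fun t => x t j 0) \is_cts) -> (fun t => (A *m x t) i 0) \is_cts.
Proof.
move=> cx.
have -> : (fun t => (A *m x t) i 0) = (fun t => \sum_j A i j * x t j 0).
  by apply/funext => t; rewrite mxE.
by apply: cts_sum => j; apply: cts_mul; [exact: cts_cst|exact: cx].
Qed.

Section OnePath.
Context {Omega : Type} {d : nat} (X : R -> Omega -> 'cV[R]_d) (w : Omega).
Hypothesis cX : forall i, (fun t => X t w i 0) \is_cts.

Lemma integral_dotv_mulmx (A B : 'M[R]_d) :
  \int[mu]_(t in `[0, T]) dotv (A *m X t w) (B *m X t w) =
  T * fdot (A *m CT T X w) B.
Proof.
under eq_Rintegral do rewrite dotv_mulmx.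
have cXX i j k : (fun t => A i j * B i k * (X t w j 0 * X t w k 0)) \is_cts.
  by apply: cts_mul; [exact: cts_cst|exact: cts_mul].
rewrite Rintegral_cts_sum => [|i]; last first.
  by do 2!apply: cts_sum => ?; exact: cXX.
rewrite fdotE mulr_sumr; apply: eq_bigr => i _.
rewrite Rintegral_cts_sum => [|j]; last by apply: cts_sum => ?; exact: cXX.
rewrite mulr_sumr.
under [in LHS] eq_bigr => j _ do rewrite Rintegral_cts_sum//.
rewrite exchange_big/=; apply: eq_bigr => k _.
rewrite mxE !mulr_suml mulr_sumr; apply: eq_bigr => j _.
rewrite !mxE RintegralZl//; first by field; rewrite gt_eqF.
by apply: (@cts_integrable _ T) => //; exact: cts_mul.
Qed.

Lemma CT_psd : psd (CT T X w).
Proof.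
split.
  apply/matrixP => i j; rewrite !mxE; congr (_ * _).
  by apply: eq_Rintegral => t _; rewrite mulrC.
move=> x; rewrite dotvE.
have [x0|x0] := eqVneq (frobenius x) 0.
  by rewrite (frobenius_eq0 x0) /fdot mulmx0 mulmx0 mxtrace0.
have xx : 0 < frobenius x ^+ 2 by rewrite exprn_gt0// lt_def x0 frobenius_ge0.
(* the integral formula for A = B = x x^T, where |x x^T X| = |x| |<x, X>| *)
have : 0 <= T * fdot (x *m x^T *m CT T X w) (x *m x^T).
  rewrite -integral_dotv_mulmx; apply: Rintegral_ge0 => t _.
  by rewrite dotvE fdot_ge0.
rewrite pmulr_rge0// -mulmxA fdot_mull mulmxA.
have -> : x^T *m x = (frobenius x ^+ 2)%:M.
  by rewrite frobenius2 /fdot trace_mx11 -mx11_scalar.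
rewrite mul_scalar_mx fdotZr pmulr_rge0// fdotC.
by rewrite /fdot trmxK mxtrace_mulC mulmxA.
Qed.

End OnePath.

(** Along one path, the sums for the integral of <A X, dX> minus those for
    <A, J> are Riemann sums for the drift, since X - W is the primitive of
    - A0 X. *)
Lemma ou_riemann_cvg d (A A0 : 'M[R]_d) (X W : R -> 'cV[R]_d) :
  (forall i, (fun t => X t i 0) \is_cts) ->
  (forall t, 0 <= t <= T -> X t =
     \col_i (\int[mu]_(s in `[0, t]) (- A0 *m X s) i 0) + W t) ->
  (fun n => riemann_sum T (usubdiv T n) (fun t => A *m X t) X +
     \sum_(p : 'I_d * 'I_d) - A p.1 p.2 *
       riemann_sum T (usubdiv T n) (fun t => row p.2 (X t)) (fun t => row p.1 (W t)))
  @ \oo --> \int[mu]_(t in `[0, T]) dotv (A *m X t) (- A0 *m X t).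
Proof.
move=> cX XE.
rewrite [X in _ --> X]Rintegral_cts_sum => [|i]; last first.
  by apply: cts_mul; exact: cts_mulmx.
pose G i t := \int[mu]_(s in `[0, t]) (- A0 *m X s) i 0.
rewrite (_ : (fun n => _) = (fun n => \sum_i \sum_(k < n.+1)
   (A *m X (upoint T n k)) i 0 *
   (G i (upoint T n k.+1) - G i (upoint T n k)))).
  apply: cvg_sumr => i.
  by apply: riemann_cvg => //; exact: cts_mulmx.
apply/funext => n.
under [in LHS]eq_bigr => p _ do rewrite riemann_sum_usubdiv mulr_sumr.
rewrite riemann_sum_usubdiv [X in _ + X]exchange_big/= -big_split/=.
rewrite exchange_big/=; apply: eq_bigr => k _.
rewrite -(pair_bigA _ (fun i j => - A i j * dotv (row j (X (upoint T n k)))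
  (row i (W (upoint T n k.+1)) - row i (W (upoint T n k)))))/=.
rewrite -big_split/=; apply: eq_bigr => i _.
rewrite (XE (upoint T n k.+1)) ?upoint_in//.
rewrite [in X in _ * X](XE (upoint T n k)) ?upoint_in ?(ltnW (ltn_ord k))//.
set a := upoint T n k; set b := upoint T n k.+1.
have -> : forall M N : 'cV[R]_d, (M + W b - (N + W a)) i 0 =
    (M i 0 - N i 0) + (W b i 0 - W a i 0).
  by move=> M N; rewrite !mxE; ring.
have -> : \sum_(j < d) - A i j * dotv (row j (X a)) (row i (W b) - row i (W a)) =
    - ((A *m X a) i 0 * (W b i 0 - W a i 0)).
  rewrite mxE mulr_suml -sumrN; apply: eq_bigr => j _.
  by rewrite /dotv big_ord1 !mxE; ring.
by rewrite [X in _ * (X - _ + _)]mxE [X in _ * (_ - X + _)]mxE -/(G i a) -/(G i b); ring.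
Qed.

Lemma ito_cvg_prob {disp : measure_display} {Omega : measurableType disp}
    (P : probability Omega R) d (H Y : R -> Omega -> 'cV[R]_d) (K : Omega -> R) :
  ito_integral P T H Y K ->
  cvg_prob P (fun n w => riemann_sum T (usubdiv T n) (H ^~ w) (Y ^~ w)) K.
Proof.
move=> [_ HK] e p e0 p0; have [dl dl0 HKd] := HK e p e0 p0.
near=> n; apply: HKd; first exact: usubdiv_partition.
move=> k; rewrite size_usubdiv => kn; rewrite nth_usubdiv// nth_usubdiv0//.
by move: k {kn}; near: n; exact: near_upoint.
Unshelve. all: by end_near. Qed.

Lemma measurable_riemann_sum {disp : measure_display} {Omega : measurableType disp}
    d (H Y : R -> Omega -> 'cV[R]_d) n :
  (forall t i, 0 <= t <= T -> measurable_fun setT (fun w => H t w i 0)) ->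
  (forall t i, 0 <= t <= T -> measurable_fun setT (fun w => Y t w i 0)) ->
  measurable_fun setT (fun w => riemann_sum T (usubdiv T n) (H ^~ w) (Y ^~ w)).
Proof.
move=> mH mY; under eq_fun do rewrite riemann_sum_usubdiv.
apply: measurable_sum => k; apply: measurable_sum => i.
have tk : 0 <= upoint T n k <= T by rewrite upoint_in// ltnW.
have tk' : 0 <= upoint T n k.+1 <= T by rewrite upoint_in.
apply: measurable_funM; first exact: mH.
under eq_fun do rewrite !mxE.
by apply: measurable_funB; exact: mY.
Qed.

Section FixedA.
Context {disp : measure_display} {Omega : measurableType disp}.
Variable P : probability Omega R.
Context {d : nat}.
Variables (A0 : 'M[R]_d) (W X : R -> Omega -> 'cV[R]_d).
Variables (J : Omega -> 'M[R]_d) (I : 'M[R]_d -> Omega -> R).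
Hypothesis mW : forall (t : R) i, 0 <= t <= T -> measurable_fun setT (fun w => W t w i 0).
Hypothesis XOU : ornstein_uhlenbeck P T A0 W X.
Hypothesis JI : ito_integral_mx P T W X J.
Hypothesis II : ito_field P T X I.

Lemma ou_path_cts : {ae P, forall w i, (fun t => X t w i 0) \is_cts}.
Proof.
case: XOU => _ _ cX _; apply: filterS cX => w cX i.
apply: (@within_continuous_comp _ _ _ `[0, T] (X ^~ w) (fun M => M i 0)) => //.
by move=> M _; exact: coord_continuous.
Qed.

Lemma ito_field_at A : {ae P, forall w,
  I A w = fdot A (J w) - T * fdot (A *m CT T X w) A0}.
Proof.
case: XOU => mX _ _ XE; case: II => IA _.
(* Z is the sequence of [ou_riemann_cvg], K its limit in probability *)
pose Z n w := riemann_sum T (usubdiv T n) (fun t => A *m X t w) (X ^~ w) +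
  \sum_(p : 'I_d * 'I_d) - A p.1 p.2 *
    riemann_sum T (usubdiv T n) (fun t => row p.2 (X t w)) (fun t => row p.1 (W t w)).
pose K w := I A w + \sum_(p : 'I_d * 'I_d) - A p.1 p.2 * J w p.1 p.2.
have mrow Y (j : 'I_d) : (forall (t : R) i, 0 <= t <= T ->
    measurable_fun setT (fun w : Omega => (Y t w : 'cV[R]_d) i 0)) ->
    forall t i, 0 <= t <= T -> measurable_fun setT (fun w => row j (Y t w) i 0).
  by move=> mY t i tT; under eq_fun do rewrite mxE; exact: mY.
have mR1 n : measurable_fun setT (fun w =>
    riemann_sum T (usubdiv T n) (fun t => A *m X t w) (X ^~ w)).
  apply: measurable_riemann_sum => // t i tT.
  under eq_fun do rewrite mxE; apply: measurable_sum => j.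
  by apply: measurable_funM => //; exact: mX.
have mR2 n (p : 'I_d * 'I_d) : measurable_fun setT (fun w => - A p.1 p.2 *
    riemann_sum T (usubdiv T n) (fun t => row p.2 (X t w)) (fun t => row p.1 (W t w))).
  apply: measurable_funM => //.
  by apply: measurable_riemann_sum => *; exact: mrow.
have mI : measurable_fun setT (I A) by case: (IA A).
have mJ p : measurable_fun setT (fun w => - A p.1 p.2 * J w p.1 p.2).
  by apply: measurable_funM => //; case: (JI p.1 p.2).
have KZ : {ae P, forall w, K w =
    \int[mu]_(t in `[0, T]) dotv (A *m X t w) (- A0 *m X t w)}.
  apply: (@cvg_prob_ae_unique _ _ _ P Z).
  - by move=> n; apply: measurable_funD => //; exact: measurable_sum.
  - by apply: measurable_funD => //; exact: measurable_sum.
  - apply: cvg_probD => //.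
    + by move=> n; exact: measurable_sum.
    + exact: measurable_sum.
    + exact: ito_cvg_prob (IA A).
    + apply: cvg_prob_sum => // p; apply: cvg_probZ.
      exact: ito_cvg_prob (JI p.1 p.2).
  - apply: filterS2 ou_path_cts XE => w cX XEw.
    exact: ou_riemann_cvg.
apply: filterS2 ou_path_cts KZ => w cX Kw.
rewrite -[LHS](addrK (\sum_(p : 'I_d * 'I_d) - A p.1 p.2 * J w p.1 p.2)).
rewrite -/(K w) Kw integral_dotv_mulmx// fdotNr mulrN addrC; congr (_ - _).
rewrite fdotE pair_bigA/= -sumrN.
by apply: eq_bigr => p _; rewrite mulNr opprK.
Qed.

(** The exceptional null set does not depend on A: rational matrices are
    countable and dense, and both sides are continuous in A. *)
Lemma ito_fieldE : {ae P, forall w, forall A,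
  I A w = fdot A (J w) - T * fdot (A *m CT T X w) A0}.
Proof.
(* an enumeration of the rational matrices *)
pose At n : 'M[R]_d := if unpickle n is Some q
  then map_mx ratr (q : 'M[rat]_d) else 0.
have rat_at : {ae P, forall w, forall n,
    I (At n) w = fdot (At n) (J w) - T * fdot (At n *m CT T X w) A0}.
  by apply: ae_foralln => n; exact: ito_field_at.
case: II => _ cI; apply: filterS2 cI rat_at => w cI IAt A.
pose L := J w - T *: (A0 *m (CT T X w)^T).
have LE B : fdot B (J w) - T * fdot (B *m CT T X w) A0 = fdot B L.
  by rewrite fdotDr fdotNr fdotZr fdot_mulr.
rewrite LE.
have cL : continuous (fun B => fdot B L).
  have -> : (fun B => fdot B L) =
            (fun B : 'M[R]_d => \sum_i \sum_j B i j * L i j).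
    by apply/funext => B; rewrite fdotE.
  apply: continuous_big => [|i _]; first exact: add_continuous.
  apply: continuous_big => [|j _ B]; first exact: add_continuous.
  by apply: continuousM; [exact: coord_continuous|exact: cst_continuous].
have cD : {for A, continuous (fun B => I B w - fdot B L)}.
  by apply: continuousB; [exact: cI|exact: cL].
apply/eqP; rewrite -subr_eq0 -normr_le0; apply/ler_addgt0Pr => e e0; rewrite add0r.
have /cvgrPdist_le/(_ _ e0)/nbhs_ballP[r /= r0 rD] := cD.
have [q qr] : exists q : 'M[rat]_d, ball A r (map_mx ratr q).
  have qa (a : R) : exists q, ball a r (ratr q).
    have /rat_in_itvoo[q /itvP qr] : a < a + r by rewrite ltrDl.
    exists q; rewrite /ball/= distrC ltr_distl qr andbT.
    by rewrite (@le_lt_trans _ _ a)// ?qr// lerBlDl lerDr ltW.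
  have [f fP] := choice qa.
  exists (\matrix_(i, j) f (A i j)); split => // i j; rewrite !mxE; exact: fP.
have := rD _ qr.
have <- : At (pickle q) = map_mx ratr q by rewrite /At pickleK.
by rewrite /= IAt LE subrr subr0.
Qed.

End FixedA.

End ItoField.

(** * The estimator along one path *)

Section Weighted.
Context {R : realType} (T : R).
Hypothesis T_gt0 : 0 < T.
Context {Omega : Type} {d : nat}.
Variables (X : R -> Omega -> 'cV[R]_d) (w : Omega) (eta : R).
Hypothesis eta_gt0 : 0 < eta.
Hypothesis cX :
  forall i, {within `[0, T], continuous (fun t => X t w i 0 : R)}.
Local Notation C := (CT T X w).
Local Notation B := (BT T X eta w).

Lemma CT_ridge_psd : psd (C + eta%:M).
Proof.
have [CT0 C0] := CT_psd T_gt0 cX; split.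
  by rewrite linearD/= CT0 tr_scalar_mx.
move=> x; rewrite mulmxDl mul_scalar_mx dotvE fdotDr fdotZr.
by rewrite addr_ge0 -?dotvE ?C0// mulr_ge0 ?(ltW eta_gt0)// dotvE fdot_ge0.
Qed.

Lemma BT_sym : B^T = B.
Proof. by have [[]] := sqrtmx_psd CT_ridge_psd. Qed.

Lemma BT_sqr : B *m B = C + eta%:M.
Proof. by have [_] := sqrtmx_psd CT_ridge_psd. Qed.

Lemma BT_unit : B \in unitmx.
Proof.
rewrite -row_free_unit -kermx_eq0; apply/eqP/row_matrixP => i.
set v := row i _; rewrite row0.
have vB : v *m B = 0 by rewrite /v -row_mul mulmx_ker row0.
have vS : v *m (C + eta%:M) = 0 by rewrite -BT_sqr mulmxA vB mul0mx.
have [_ /(_ v^T)] := CT_psd T_gt0 cX; rewrite dotvE => C0.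
have : fdot v^T ((C + eta%:M) *m v^T) = 0.
  have [CS _] := CT_ridge_psd.
  by rewrite -CS -trmx_mul vS trmx0 /fdot mulmx0 mxtrace0.
rewrite mulmxDl mul_scalar_mx fdotDr fdotZr => h.
have h1 := fdot_ge0 v^T.
have /eqP : eta * fdot v^T v^T = 0.
  by have := mulr_ge0 (ltW eta_gt0) h1; lra.
rewrite mulf_eq0 gt_eqF//= => /eqP/fdot_eq0 v0.
by rewrite -[LHS]trmxK v0 trmx0.
Qed.

Variables (J : Omega -> 'M[R]_d) (I : 'M[R]_d -> Omega -> R) (A0 : 'M[R]_d).
Hypothesis IE : forall A, I A w = fdot A (J w) - T * fdot (A *m C) A0.

(** Completing the square in A B. *)
Lemma objectiveE (lambda : R) A :
  objective T X I lambda eta w A =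
  (frobenius (A *m B - A0 *m B) ^+ 2 / 2
   + fdot (A *m B) (epsT T J w *m invmx B)
   + fdot (A *m B) (eta *: (A0 *m invmx B))
   + lambda * nuclear (A *m B))
  - fdot (A0 *m (C + eta%:M)) A0 / 2.
Proof.
rewrite /objective /contrast IE.
have -> : \int[lebesgue_measure]_(t in `[0, T]) (frobenius (A *m X t w) ^+ 2) =
    T * fdot (A *m C) A.
  rewrite -integral_dotv_mulmx//; apply: eq_Rintegral => t _.
  by rewrite frobenius2 dotvE.
have BB M N : fdot (M *m B) (N *m B) = fdot (M *m C) N + eta * fdot M N.
  rewrite fdotC fdot_mulr BT_sym -mulmxA BT_sqr fdotC mulmxDr fdotDl.
  by rewrite mul_mx_scalar fdotZl.
have BV M N : fdot (M *m B) (N *m invmx B) = fdot M N.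
  by rewrite fdot_mulr BT_sym mulmxKV// BT_unit.
have CS : C^T = C by have [] := CT_psd T_gt0 cX.
rewrite -mulmxBl !frobenius2 BB fdotZr !BV mulmxBl !fdot_lin.
rewrite mulmxDr fdotDl mul_mx_scalar fdotZl.
rewrite [fdot (A0 *m C) A]fdot_mulr CS (fdotC A0 (A *m C)) (fdotC A0 A).
by field; rewrite gt_eqF.
Qed.

(** The infimum over A is taken last, the bound being affine in
    [frobenius ((A - A0) *m B) ^+ 2] with slope 4. *)
Lemma oracle_inequality (lambda : R) (Ahat : 'M[R]_d) (r : nat) :
  0 < lambda -> score_event T X J lambda eta w ->
  wnen_estimate T X I lambda eta w Ahat ->
  frobenius ((Ahat - A0) *m B) ^+ 2 <=
    4 * approx_error T X A0 r eta w + 48 * lambda ^+ 2 * r%:R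
    + 12 * eta ^+ 2 * frobenius (A0 *m invmx B) ^+ 2.
Proof.
move=> l0 score Amin.
have Zl : opbound (lambda / 2) (epsT T J w *m invmx B).
  move=> x; rewrite (le_trans (opbound_opnorm _ _))// ler_wpM2r ?frobenius_ge0//.
  by rewrite ler_pdivlMr// mulrC.
rewrite -addrA -lerBlDr -ler_pdivrMl//.
rewrite /approx_error; apply: lb_le_inf.
  by exists (frobenius ((0 - A0) *m B) ^+ 2), 0 => //=; rewrite mxrank0.
move=> _ [A /= rA <-]; rewrite ler_pdivrMl// lerBlDr addrA.
have := Amin A; rewrite !objectiveE lerD2r.
move=> /(nuclear_oracle l0 Zl); rewrite -!mulmxBl frobeniusZ exprMn.
rewrite real_normK ?num_real// (mulrA 12) => /le_trans; apply.
rewrite lerD2r lerD2l; apply: ler_wpM2l; first by rewrite mulr_ge0 ?sqr_ge0.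
rewrite ler_nat; exact: leq_trans (mxrankM_maxl _ _) rA.
Qed.

End Weighted.

Unset Implicit Arguments.

Theorem theorem3p3 (R : realType) :
  exists C1 C2 C3 : R, [/\ 0 < C1, 0 < C2 & 0 < C3] /\
  forall (disp : measure_display) (Omega : measurableType disp)
    (P : probability Omega R) (T : R) (d : nat) (A0 : 'M[R]_d)
    (W X : R -> Omega -> 'cV[R]_d)
    (J : Omega -> 'M[R]_d) (I : 'M[R]_d -> Omega -> R),
  0 < T ->
  brownian P T W ->
  ornstein_uhlenbeck P T A0 W X ->
  ito_integral_mx P T W X J ->
  ito_field P T X I ->
  forall lambda eta : R, 0 < lambda -> 0 < eta ->
  {ae P, forall w, score_event T X J lambda eta w ->
    forall Ahat : 'M[R]_d, wnen_estimate T X I lambda eta w Ahat ->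
    forall r : nat, (r <= d)%N ->
      frobenius ((Ahat - A0) *m BT T X eta w) ^+ 2 <=
        C1 * approx_error T X A0 r eta w
        + C2 * lambda ^+ 2 * r%:R
        + C3 * eta ^+ 2 * frobenius (A0 *m invmx (BT T X eta w)) ^+ 2}
  /\
  forall c0 piT : R, 0 < c0 -> 0 <= piT <= 1 ->
  ((1 - piT)%:E <= P (curvature_event T X eta c0))%E ->
  {ae P, forall w,
    (score_event T X J lambda eta `&` curvature_event T X eta c0) w ->
    forall Ahat : 'M[R]_d, wnen_estimate T X I lambda eta w Ahat ->
    forall r : nat, (r <= d)%N ->
      frobenius (Ahat - A0) ^+ 2 <=
        C1 / c0 * approx_error T X A0 r eta w
        + C2 / c0 * lambda ^+ 2 * r%:R
        + C3 / c0 * eta ^+ 2 * frobenius (A0 *m invmx (BT T X eta w)) ^+ 2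
        <= C1 / c0 * approx_error T X A0 r eta w
        + C2 / c0 * lambda ^+ 2 * r%:R
        + C3 / c0 ^+ 2 * eta ^+ 2 * frobenius A0 ^+ 2}.
Proof.
exists 4, 48, 12; split; first by split; lra.
move=> disp Omega P T d A0 W X J I T0 BW OU JI II lambda eta l0 e0.
have mW : forall (t : R) i, 0 <= t <= T -> measurable_fun setT (fun w => W t w i 0).
  by case: BW.
have oracle : {ae P, forall w, score_event T X J lambda eta w ->
    forall Ahat : 'M[R]_d, wnen_estimate T X I lambda eta w Ahat ->
    forall r : nat, (r <= d)%N ->
      frobenius ((Ahat - A0) *m BT T X eta w) ^+ 2 <=
        4 * approx_error T X A0 r eta w
        + 48 * lambda ^+ 2 * r%:R
        + 12 * eta ^+ 2 * frobenius (A0 *m invmx (BT T X eta w)) ^+ 2}.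
  apply: filterS2 (ou_path_cts OU) (ito_fieldE T0 mW OU JI II).
  move=> w cX IE score Ahat Amin r _.
  exact: (oracle_inequality T0 e0 cX IE).
split=> // c0 piT c00 _ _.
apply: filterS2 (ou_path_cts OU) oracle => w cX oracle [score curv] Ahat Amin r rd.
(* curvature at Ahat - A0 for the first bound, at A0 B^-1 for the second *)
have := oracle score Ahat Amin r rd; have := curv (Ahat - A0).
have := curv (A0 *m invmx (BT T X eta w)); rewrite mulmxKV ?BT_unit//.
move: (frobenius (A0 *m _) ^+ 2) (frobenius A0 ^+ 2) (frobenius (Ahat - A0) ^+ 2).
move: (frobenius _ ^+ 2) (approx_error _ _ _ _ _ _) => y a u v x h1 h2 h3.
have c0' : c0 != 0 by rewrite gt_eqF.
apply/andP; split.
  rewrite (_ : _ + _ + _ = (4 * a + 48 * lambda ^+ 2 * r%:R + 12 * eta ^+ 2 * u) / c0);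
    last by field.
  by rewrite ler_pdivlMr// mulrC (le_trans h2).
rewrite lerD2l (_ : 12 / c0 * _ * u = 12 / c0 * eta ^+ 2 * u)//.
rewrite (_ : 12 / c0 ^+ 2 * _ * v = 12 / c0 * eta ^+ 2 * (v / c0)); last by field.
apply: ler_wpM2l; first by rewrite mulr_ge0 ?sqr_ge0// divr_ge0// ltW.
by rewrite ler_pdivlMr// mulrC.
Qed.
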